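(* Let $\mathscr{M}=(\mathsf{M},\tau,\mathfrak{m})$ and $\mathscr{M}'=(\mathsf{M}',\tau',\mathfrak{m}')$ be normalized bounded Lorentzian metric measure spaces. The following are equivalent. (i) $\mathscr{M}$ and $\mathscr{M}'$ are isomorphic. (ii) There exists a coupling $\pi$ of $\mathfrak{m}$ and $\mathfrak{m}'$ such that $\tau(x,y)=\tau'(x',y')$ for $\pi^{\otimes2}$-a.e. $(x,x',y,y')\in(\mathsf{M}\times\mathsf{M}')^2$. (iii) There exist a normalized bounded Lorentzian metric measure space $\hat{\mathscr{M}}=(\hat{\mathsf{M}},\hat\tau,\hat{\mathfrak{m}})$ with spacelike boundary $\hat\imath^0$ and $\mathrm{spt}\,\hat{\mathfrak{m}}\cup\{\hat\imath^0\}=\hat{\mathsf{M}}$ as well as distance-preserving maps $\hat\iota\colon\hat{\mathsf{M}}\to\mathrm{spt}\,q_\sharp\mathfrak{m}\cup\{i^0\}$ and $\hat\iota'\colon\hat{\mathsf{M}}\to\mathrm{spt}\,q'_\sharp\mathfrak{m}'\cup\{i'^0\}$ with $\hat\iota_\sharp\hat{\mathfrak{m}}=q_\sharp\mathfrak{m}$ and $\hat\iota'_\sharp\hat{\mathfrak{m}}=q'_\sharp\mathfrak{m}'$.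
   Context: A bounded Lorentzian metric space is a pair $(\mathsf{M},\tau)$ of a nonempty set $\mathsf{M}$ and a function $\tau\colon\mathsf{M}^2\to[0,\infty)$ such that: (a) $\tau(x,y)+\tau(y,z)\le\tau(x,z)$ whenever $\tau(x,y)>0$ and $\tau(y,z)>0$; (b) there is a topology $T$ on $\mathsf{M}$ such that $\tau$ is continuous for the product topology $T^2$ and $\{\tau\ge\varepsilon\}\subset\mathsf{M}^2$ is compact for every $\varepsilon>0$; (c) for all distinct $x,y\in\mathsf{M}$ there is $z\in\mathsf{M}$ with $\tau(x,z)\ne\tau(y,z)$ or $\tau(z,x)\neq\tau(z,y)$. All topological and Borel notions on $\mathsf{M}$ refer to the coarsest topology satisfying (b), which exists and is Polish. A normalized bounded Lorentzian metric measure space is a triple $\mathscr{M}=(\mathsf{M},\tau,\mathfrak{m})$ with $(\mathsf{M},\tau)$ a bounded Lorentzian metric space and $\mathfrak{m}$ a Borel probability measure on $\mathsf{M}$ (not necessarily of full support). A coupling of $\mathfrak{m}$ and $\mathfrak{m}'$ is a Borel probability measure on $\mathsf{M}\times\mathsf{M}'$ with marginals $\mathfrak{m}$ and $\mathfrak{m}'$. A map $\iota$ between bounded Lorentzian metric spaces is distance-preserving if it preserves the time separation functions, i.e. the function $\tau$ of the source at $(x,y)$ equals that of the target at $(\iota(x),\iota(y))$ for all $x,y$. Isomorphy. The spacelike boundary $i^0$ of a bounded Lorentzian metric space is the (unique, if it exists) point with $\tau(i^0,x)=\tau(x,i^0)=0$ for every $x$. On $\mathrm{spt}\,\mathfrak{m}$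 define $x\sim y$ if $\tau(x,z)=\tau(y,z)$ and $\tau(z,x)=\tau(z,y)$ for every $z\in\mathrm{spt}\,\mathfrak{m}$. Let $q\colon\mathrm{spt}\,\mathfrak{m}\to\tilde{\mathsf{M}}$ be the quotient projection and $\tilde\tau(q(x),q(y)):=\tau(x,y)$; then $(\tilde{\mathsf{M}},\tilde\tau)$ is a bounded Lorentzian metric space (the distance quotient), and $\mathrm{spt}\,q_\sharp\mathfrak{m}=\tilde{\mathsf{M}}$, where $\sharp$ denotes push-forward. Write $\mathrm{spt}\,q_\sharp\mathfrak{m}\cup\{i^0\}$ for this space itself if it already has a spacelike boundary, and otherwise for the bounded Lorentzian metric space obtained by adjoining an abstract point $i^0$ (of zero measure) and extending $\tilde\tau$ by zero to pairs involving $i^0$. Use primes for the analogous objects of $\mathscr{M}'$. $\mathscr{M}$ and $\mathscr{M}'$ are isomorphic if there is a distance-preserving Borel measurable map $\iota\colon\mathrm{spt}\,q_\sharp\mathfrak{m}\cup\{i^0\}\to\mathrm{spt}\,q'_\sharp\mathfrak{m}'\cup\{i'^0\}$ with $\iota_\sharp(q_\sharp\mathfrak{m})=q'_\sharp\mathfrak{m}'$. *)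

(* Defs.v *)
From HB Require Import structures.
From mathcomp Require Import all_boot all_order all_algebra generic_quotient.
From mathcomp Require Import all_classical all_reals all_analysis.

Set Implicit Arguments.
Unset Strict Implicit.
Unset Printing Implicit Defensive.

Import Order.TTheory GRing.Theory Num.Theory.
Import numFieldNormedType.Exports.

Local Open Scope classical_set_scope.
Local Open Scope ring_scope.
Local Open Scope quotient_scope.

Record topology (X : Type) := Topology {
  opens : set (set X);
  opensT : opens setT;
  opensI : setI_closed opens;
  opens_bigU : forall (I : Type) (f : I -> set X),
    (forall i, opens (f i)) -> opens (\bigcup_i f i) }.

Definition top_space (X : pointedType) (T : topology X) : Type := X.

HB.instance Definition _ (X : pointedType) (T : topology X) :=
  Pointed.on (top_space T).

HB.instance Definition _ (X : pointedType) (T : topology X) :=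
  isOpenTopological.Build (top_space T)
    (opensT T) (@opensI X T) (@opens_bigU X T).

(* The nonempty underlying sets are modelled by pointed types; the
   distinguished point plays no role. *)
Section BoundedLorentzianMetricSpace.
Context (R : realType) (X : pointedType) (tau : X -> X -> R).

Definition tau_topology (T : topology X) : Prop :=
  continuous (fun p : top_space T * top_space T => tau p.1 p.2) /\
  (forall e : R, 0 < e ->
    compact [set p : top_space T * top_space T | e <= tau p.1 p.2]).

Record is_blms : Prop := IsBLMS {
  blms_ge0 : forall x y, 0 <= tau x y;
  blms_reverse_triangle : forall x y z,
    0 < tau x y -> 0 < tau y z -> tau x y + tau y z <= tau x z;
  blms_topology : exists T : topology X, tau_topology T;
  blms_separation : forall x y : X, x <> y ->
    exists z, tau x z <> tau y z \/ tau z x <> tau z y }.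

Let coarsest_opens : set (set X) :=
  [set U | forall T, tau_topology T -> opens T U].

Let coarsest_opensT : coarsest_opens setT.
Proof. by move=> T _; exact: opensT. Qed.

Let coarsest_opensI : setI_closed coarsest_opens.
Proof. by move=> U V hU hV T hT; apply: opensI; [exact: hU|exact: hV]. Qed.

Let coarsest_opens_bigU (I : Type) (f : I -> set X) :
  (forall i, coarsest_opens (f i)) -> coarsest_opens (\bigcup_i f i).
Proof. by move=> hf T hT; apply: opens_bigU => i; exact: hf. Qed.

(* The intersection of all topologies satisfying [tau_topology]: it is the
   coarsest such topology as soon as a coarsest one exists. *)
Definition coarsest_topology : topology X :=
  Topology coarsest_opensT coarsest_opensI coarsest_opens_bigU.

End BoundedLorentzianMetricSpace.

Notation lspace tau := (top_space (coarsest_topology tau)).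

Definition is_spacelike_boundary (R : realType) (X : Type)
    (tau : X -> X -> R) (i : X) : Prop :=
  forall x, tau i x = 0 /\ tau x i = 0.

Definition distance_preserving (R : realType) (X Y : Type)
    (tau : X -> X -> R) (tau' : Y -> Y -> R) (f : X -> Y) : Prop :=
  forall x y, tau x y = tau' (f x) (f y).

Notation borel T := (g_sigma_algebraType (@open T)).

(* Normalized bounded Lorentzian metric measure spaces. *)
Record nblmms (R : realType) := NBLMMS {
  pt :> pointedType;
  tsep : pt -> pt -> R;
  tsepP : is_blms tsep;
  meas : probability (borel (lspace tsep)) R }.
Arguments tsep {R} n _ _.
Arguments meas {R} n.

Notation tspace M := (lspace (tsep M)).

Definition spt (R : realType) (M : nblmms R) : set (tspace M) :=
  [set x | forall U : set (tspace M), open U -> U x -> (0 < meas M U)%E].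
Arguments spt {R} M _.

Section DistanceQuotient.
Context (R : realType) (M : nblmms R).

Definition indist (x y : spt M) : bool :=
  `[< forall z : spt M, tsep M (val x) (val z) = tsep M (val y) (val z) /\
                        tsep M (val z) (val x) = tsep M (val z) (val y) >].

Let indist_refl : reflexive indist.
Proof. by move=> x; apply/asboolP. Qed.

Let indist_sym : symmetric indist.
Proof.
by move=> x y; apply/asboolP/asboolP => h z; have [-> ->] := h z.
Qed.

Let indist_trans : transitive indist.
Proof.
move=> y x z /asboolP hxy /asboolP hyz; apply/asboolP => w.
by have [-> ->] := hxy w.
Qed.

Canonical indist_equiv := EquivRel indist indist_refl indist_sym indist_trans.

Definition dquot : Type := {eq_quot indist_equiv}.
HB.instance Definition _ := Choice.on dquot.

Definition qproj (x : spt M) : dquot := \pi_({eq_quot indist_equiv}) x.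

Definition qtsep (a b : dquot) : R :=
  tsep M (val (repr (a : {eq_quot indist_equiv})))
       (val (repr (b : {eq_quot indist_equiv}))).

Lemma qtsepE (x y : spt M) : qtsep (qproj x) (qproj y) = tsep M (val x) (val y).
Proof.
have h (z : spt M) : indist (repr (qproj z : {eq_quot indist_equiv})) z.
  by apply/(eqquotP {eq_quot indist_equiv}); rewrite reprK.
rewrite /qtsep; have /asboolP hx := h x; have /asboolP hy := h y.
by rewrite (hx _).1 (hy x).2.
Qed.

End DistanceQuotient.
Arguments qtsep {R} M _ _.

(* The space obtained by adjoining an abstract point [None] with vanishing
   time separations, unless a spacelike boundary is already present. *)
Section AdjoinBoundary.
Context (R : realType) (X : choiceType) (tau : X -> X -> R).

Let has_boundary : Prop := exists i, is_spacelike_boundary tau i.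

Definition with_i0 : Type :=
  [set o : option X | o = None -> ~ has_boundary].

HB.instance Definition _ := Choice.on with_i0.

Lemma with_i0_some (x : X) :
  Some x \in [set o : option X | o = None -> ~ has_boundary].
Proof. by rewrite inE. Qed.

Definition to_with_i0 (x : X) : with_i0 := exist _ (Some x) (with_i0_some x).

Definition tau_i0 (a b : with_i0) : R :=
  match val a, val b with Some x, Some y => tau x y | _, _ => 0 end.

Lemma with_i0_inhabited : $| with_i0 |.
Proof.
have [[i _]|h] := pselect has_boundary; first exact: squash (to_with_i0 i).
by apply: squash; exists None; rewrite inE.
Qed.

HB.instance Definition _ := isPointed.Build with_i0 (unsquash with_i0_inhabited).

End AdjoinBoundary.

Section QuotientWithBoundary.
Context (R : realType) (M : nblmms R).

Definition qi0 : Type := with_i0 (qtsep M).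
HB.instance Definition _ := Pointed.on qi0.

Definition qi0_tsep : qi0 -> qi0 -> R := tau_i0 (tau := qtsep M).

(* The push-forward of the measure of M under qproj, viewed on qi0; the
   measure of M lives on spt M, and an adjoined point has measure zero. *)
Definition qi0_meas (A : set (borel (lspace qi0_tsep))) : \bar R :=
  meas M [set val x | x in
    (fun x : spt M => to_with_i0 (qtsep M) (qproj x)) @^-1` A].

End QuotientWithBoundary.
Arguments qi0_tsep {R} M _ _.
Arguments qi0_meas {R} M _.

Notation qi0_space M := (lspace (qi0_tsep M)).

Definition isomorphic (R : realType) (M M' : nblmms R) : Prop :=
  exists iota : borel (qi0_space M) -> borel (qi0_space M'),
    [/\ distance_preserving (qi0_tsep M) (qi0_tsep M') iota,
        measurable_fun setT iota &
        forall A, measurable A ->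
          pushforward (qi0_meas M) iota A = qi0_meas M' A].

Definition is_coupling (R : realType) (M M' : nblmms R)
    (pi : probability (borel (tspace M * tspace M')%type) R) : Prop :=
  (forall A : set (borel (tspace M)), measurable A ->
     pushforward pi (fst : _ -> borel (tspace M)) A = meas M A) /\
  (forall A : set (borel (tspace M')), measurable A ->
     pushforward pi (snd : _ -> borel (tspace M')) A = meas M' A).

(* Main.v *)
(** The coarsest admissible topology of a bounded Lorentzian metric space is
    generated by countably many time separation functions; it is Hausdorff,
    second countable and sigma-compact, so that finite Borel measures are inner
    regular for compact sets.  A distance-preserving correspondence between two
    such spaces with dense projections reaches every point except possibly the
    spacelike boundary: close to any other point some time separation is bounded
    below, which confines the correspondence to a compact set.  Hence a common
    extension as in (iii), or the support of a coupling as in (ii), is the graph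
    of an isomorphism of the quotients.

    Conversely, an isomorphism yields two maps, from [M] and from [M'], into the
    quotient of [M'] with the same image measure.  The couplings that are product
    measures conditionally on the cells of finer and finer finite partitions of
    this quotient converge along an ultrafilter to a finitely additive coupling;
    compact regularity of the marginals makes it countably additive, and it is
    supported on the fibre product of the two maps. *)

Require Import Defs.
From HB Require Import structures.
From mathcomp Require Import all_boot all_order all_algebra generic_quotient.
From mathcomp Require Import all_classical all_reals all_analysis.
From mathcomp Require Import lra.

Set Implicit Arguments.
Unset Strict Implicit.
Unset Printing Implicit Defensive.

Import Order.TTheory GRing.Theory Num.Theory.
Import numFieldNormedType.Exports.

Local Open Scope classical_set_scope.
Local Open Scope ring_scope.
Local Open Scope quotient_scope.

(** * The topology of a bounded Lorentzian metric space *)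

(** The distance quotient comes without a topology, and admissibility demands compact superlevel
    sets and joint continuity at once. Both are therefore derived for an arbitrary map into the
    space that preserves the time separations, has compact superlevel sets upstairs and misses at
    most the boundary. The identity then gives the coarsest topology of the space itself, and the
    projection from the support gives that of the quotient.

    The spacelike boundary is exceptional because its separations vanish, so that compactness of
    superlevel sets gives no control near it. A correspondence may miss it; having one on both sides
    provides a value for the isomorphism there.

    The finite partitions stand in for a disintegration over the quotient: conditioning on a cell is
    a division by its mass. Countable additivity may be lost in the limit, but the constraints to be
    kept, namely the marginals and the nullity of mismatched pairs, concern rectangles only, and on
    rectangles the marginals restore it. *)

Lemma setC_nbhs (T : topologicalType) (A : set T) (x : T) :
  closed A -> ~ A x -> nbhs x (~` A).
Proof. by move=> cA nAx; apply: open_nbhs_nbhs; split => //; exact: closed_openC. Qed.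

Lemma hausdorff_prod (T U : topologicalType) :
  hausdorff_space T -> hausdorff_space U -> hausdorff_space (T * U)%type.
Proof.
move=> hT hU [a b] [c d] cl; congr (_, _).
- apply: hT => A B nA nB.
  have [||[u v] [/= Au Bu]] := cl (A `*` setT) (B `*` setT).
  + by exists (A, setT) => //=; split => //; exact: filterT.
  + by exists (B, setT) => //=; split => //; exact: filterT.
  by exists u; split; [exact: Au.1|exact: Bu.1].
- apply: hU => A B nA nB.
  have [||[u v] [/= Au Bu]] := cl (setT `*` A) (setT `*` B).
  + by exists (setT, A) => //=; split => //; exact: filterT.
  + by exists (setT, B) => //=; split => //; exact: filterT.
  by exists v; split; [exact: Au.2|exact: Bu.2].
Qed.

(* The countable network of closed sets makes open sets F-sigma and replaces
   metrizability. *)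
Record tame_space (T : topologicalType) : Prop := TameSpace {
  tame_hausdorff : hausdorff_space T;
  tame_base : exists B : nat -> set T, (forall n, open (B n)) /\
    forall (U : set T) x, open U -> U x -> exists n, B n x /\ B n `<=` U;
  tame_network : exists G : nat -> set T, (forall n, closed (G n)) /\
    forall (U : set T) x, open U -> U x -> exists n, G n x /\ G n `<=` U;
  tame_sigma_compact : exists C : nat -> set T, (forall n, compact (C n)) /\
    \bigcup_n C n = setT }.

(** * Initial topologies of countable families of real functions *)

Section InitialTopology.
Context (R : realType) (X : pointedType) (J : countType) (g : J -> X -> R).

(** An index encodes a strict bound on [g j], upper for [true] and lower for [false]. Rational
    thresholds keep [seq I] countable, hence also the base of cells. *)
Let I : countType := (J * bool * rat)%type.

Let halfline (i : I) : set X :=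
  [set x | if i.1.2 then g i.1.1 x < ratr i.2 else ratr i.2 < g i.1.1 x].

Let closed_halfline (i : I) : set X :=
  [set x | if i.1.2 then g i.1.1 x <= ratr i.2 else ratr i.2 <= g i.1.1 x].

Let cell (s : seq I) : set X := [set x | forall i, i \in s -> halfline i x].

Let closed_cell (s : seq I) : set X :=
  [set x | forall i, i \in s -> closed_halfline i x].

Let init_opens : set (set X) :=
  [set U | forall x, U x -> exists s, cell s x /\ cell s `<=` U].

Let init_opensT : init_opens setT.
Proof. by move=> x _; exists [::]; split. Qed.

Let init_opensI : setI_closed init_opens.
Proof.
move=> U V oU oV x [/oU[s [sx sU]] /oV[t [tx tV]]]; exists (s ++ t); split.
  by move=> i; rewrite mem_cat => /orP[/sx|/tx].
by move=> y h; split; [apply: sU|apply: tV] => i it; apply: h;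
  rewrite mem_cat it ?orbT.
Qed.

Let init_opens_bigU (K : Type) (f : K -> set X) :
  (forall i, init_opens (f i)) -> init_opens (\bigcup_i f i).
Proof.
move=> hf x [i _ /(hf i) [s [sx sU]]]; exists s; split => // y /sU fy.
by exists i.
Qed.

Definition init_topology : topology X :=
  Topology init_opensT init_opensI init_opens_bigU.

Local Notation Y := (top_space init_topology).

Let open_cell s : open (cell s : set Y).
Proof. by move=> x sx; exists s; split. Qed.

Let open_halfline i : open (halfline i : set Y).
Proof.
have -> : halfline i = cell [:: i].
  apply/seteqP; split => x h; first by move=> j; rewrite inE => /eqP->.
  by apply: h; rewrite inE.
exact: open_cell.
Qed.

Lemma init_continuous j : continuous (g j : Y -> R).
Proof.
move=> x; apply/(@cvgrPdist_lt _ _ _ _ (nbhs_filter (x : Y))) => e e0.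
have [p] : exists q : rat, ratr q \in `]g j x - e, g j x[.
  by apply: rat_in_itvoo; lra.
rewrite in_itv/= => /andP[p1 p2].
have [q] : exists q : rat, ratr q \in `]g j x, g j x + e[.
  by apply: rat_in_itvoo; lra.
rewrite in_itv/= => /andP[q1 q2].
have n1 : nbhs (x : Y) (halfline (j, false, p)).
  by apply: open_nbhs_nbhs; split => //; exact: open_halfline.
have n2 : nbhs (x : Y) (halfline (j, true, q)).
  by apply: open_nbhs_nbhs; split => //; exact: open_halfline.
apply: filterS2 n1 n2 => y; rewrite /halfline/= => y1 y2.
by rewrite ltr_distl; apply/andP; split; lra.
Qed.

Lemma cvg_init (T : Type) (F : set_system T) (FF : Filter F) (h : T -> Y)
    (x : Y) :
  (forall j, (g j \o h) t @[t --> F] --> g j x) -> h t @[t --> F] --> x.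
Proof.
move=> hj A [U [oU Ux UA]]; have [s [sx sU]] := oU _ Ux.
suff : F [set t | cell s (h t)] by apply: filterS => t /sU /UA.
move: sx {sU}; elim: s => [|[[j b] q] s IH] sx; first by apply: filterS filterT.
have h1 : F [set t | halfline (j, b, q) (h t)].
  have := sx (j, b, q); rewrite mem_head => /(_ isT).
  rewrite /halfline/=; case: b {sx} => xq.
    exact: (cvgr_lt _ (hj j) _ xq).
  exact: (cvgr_gt _ (hj j) _ xq).
have h2 : F [set t | cell s (h t)].
  by apply: IH => i si; apply: sx; rewrite inE si orbT.
apply: filterS2 h1 h2 => t t1 t2 i; rewrite inE => /orP[/eqP->//|]; exact: t2.
Qed.

Lemma init_hausdorff : (forall x y, (forall j, g j x = g j y) -> x = y) ->
  hausdorff_space Y.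
Proof.
move=> sep x y cl; apply: sep => j; apply: (@Rhausdorff R) => A B nA nB.
have [||z [Az Bz]] := cl (g j @^-1` A) (g j @^-1` B).
- exact: (@init_continuous j x).
- exact: (@init_continuous j y).
by exists (g j z).
Qed.

Let closed_closed_halfline i : closed (closed_halfline i : set Y).
Proof.
case: i => [[j b] q]; rewrite /closed_halfline/=; case: b.
  have -> : [set x | g j x <= ratr q] = g j @^-1` [set z | z <= ratr q] by [].
  by apply: closed_comp => [x _|]; [exact: init_continuous|exact: closed_le].
have -> : [set x | ratr q <= g j x] = g j @^-1` [set z | ratr q <= z] by [].
by apply: closed_comp => [x _|]; [exact: init_continuous|exact: closed_ge].
Qed.

Let closed_closed_cell s : closed (closed_cell s : set Y).
Proof.
have -> : closed_cell s = \bigcap_(i in [set i | i \in s]) closed_halfline i.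
  by apply/seteqP; split.
by apply: closed_bigI => i _; exact: closed_closed_halfline.
Qed.

(** Each threshold moves to a rational strictly between its old place and the value at [x]. This
    yields the countable closed network. *)
Let closed_cell_shrink s x : cell s x ->
  exists t, closed_cell t x /\ closed_cell t `<=` cell s.
Proof.
elim: s => [|[[j b] q] s IH] sx; first by exists [::]; split => // y _ i.
have [|t [tx ts]] := IH.
  by move=> i si; apply: sx; rewrite inE si orbT.
have [p [px ps]] : exists p, closed_halfline (j, b, p) x /\
    closed_halfline (j, b, p) `<=` halfline (j, b, q).
  have := sx (j, b, q); rewrite mem_head => /(_ isT).
  rewrite /halfline/closed_halfline/=; case: b {sx} => xq.
    have [p] := rat_in_itvoo xq; rewrite in_itv/= => /andP[p1 p2].
    by exists p; split; [exact: ltW|move=> y /=; lra].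
  have [p] := rat_in_itvoo xq; rewrite in_itv/= => /andP[p1 p2].
  by exists p; split; [exact: ltW|move=> y /=; lra].
exists ((j, b, p) :: t); split.
  by move=> i; rewrite inE => /orP[/eqP->//|]; exact: tx.
move=> y ty i; rewrite inE => /orP[/eqP->|si].
  by apply: ps; apply: ty; rewrite mem_head.
by apply: ts si => k kt; apply: ty; rewrite inE kt orbT.
Qed.

Let decode (n : nat) : seq I := odflt [::] (choice.unpickle n).

Lemma init_tame : (forall x y, (forall j, g j x = g j y) -> x = y) ->
  (exists C : nat -> set Y, (forall n, compact (C n)) /\ \bigcup_n C n = setT) ->
  tame_space Y.
Proof.
move=> sep sc; split => //; first exact: init_hausdorff.
- exists (fun n => cell (decode n)); split=> [n|U x oU Ux]; first exact: open_cell.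
  have [s [sx sU]] := oU _ Ux.
  by exists (choice.pickle s); rewrite /decode choice.pickleK.
- exists (fun n => closed_cell (decode n)).
  split=> [n|U x oU Ux]; first exact: closed_closed_cell.
  have [s [sx sU]] := oU _ Ux; have [t [tx ts]] := closed_cell_shrink sx.
  exists (choice.pickle t); rewrite /decode choice.pickleK; split => //.
  exact: subset_trans sU.
Qed.

Lemma init_coarsest (T : topology X) :
  (forall j, continuous (g j : top_space T -> R)) ->
  forall U, opens init_topology U -> opens T U.
Proof.
move=> hg U oU.
have hc s : opens T (cell s).
  elim: s => [|[[j b] q] s IH].
    by rewrite (_ : cell [::] = setT); [exact: opensT|apply/seteqP; split].
  have -> : cell ((j, b, q) :: s) = halfline (j, b, q) `&` cell s.
    apply/seteqP; split=> [x sx|x [x1 x2] i].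
      by split=> [|i si]; apply: sx; rewrite inE ?eqxx// si orbT.
    by rewrite inE => /orP[/eqP->//|]; exact: x2.
  apply: opensI => //.
  suff : open (halfline (j, b, q) : set (top_space T)) by [].
  rewrite /halfline/=; case: b.
    have -> : [set x | g j x < ratr q] = g j @^-1` [set z | z < ratr q] by [].
    by apply: open_comp => [x _|]; [exact: hg|exact: open_lt].
  have -> : [set x | ratr q < g j x] = g j @^-1` [set z | ratr q < z] by [].
  by apply: open_comp => [x _|]; [exact: hg|exact: open_gt].
have -> : U = \bigcup_(s : {s : seq I | cell s `<=` U}) cell (sval s).
  apply/seteqP; split=> [x /oU[s [sx sU]]|x [[s sU] _ /sU//]].
  by exists (exist _ s sU).
exact: opens_bigU.
Qed.

End InitialTopology.

Lemma continuous_sections (P Q T : topologicalType) (s : P -> Q -> T) :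
  continuous (fun p : P * Q => s p.1 p.2) ->
  (forall c, continuous (s c)) /\ (forall c, continuous (s^~ c)).
Proof.
move=> hs; split=> c x.
  have h : (c, q) @[q --> x] --> (c, x).
    by apply: cvg_pair; [exact: cvg_cst|exact: cvg_id].
  exact: (cvg_comp _ _ h (hs (c, x))).
have h : (q, c) @[q --> x] --> (x, c).
  by apply: cvg_pair; [exact: cvg_id|exact: cvg_cst].
exact: (cvg_comp _ _ h (hs (x, c))).
Qed.

(** * Existence of an admissible topology *)

Definition tau_sections (R : realType) (Y : Type) (tau : Y -> Y -> R)
    (d : nat -> Y) (j : nat * bool) (y : Y) : R :=
  if j.2 then tau (d j.1) y else tau y (d j.1).

(** Joint continuity and compactness of [B] make the sections at nearby points uniformly close on
    [B]; compactness of [A] then leaves finitely many centres. *)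
Lemma uniform_sections (R : realType) (P : topologicalType) (s : P -> P -> R)
    (A B : set P) (e : R) :
  continuous (fun p : P * P => s p.1 p.2) -> compact A -> compact B -> 0 < e ->
  exists l : seq P, (forall x, x \in l -> A x) /\
    forall x, A x -> exists2 c, c \in l &
      forall y, B y -> `|s x y - s c y| < e /\ `|s y x - s y c| < e.
Proof.
move=> hs cA cB e0.
pose close (x c : P) := forall y, B y -> `|s x y - s c y| < e /\ `|s y x - s y c| < e.
have near_close c : \forall x \near c, close x c.
  rewrite /close; move/compact_near_coveringP : cB.
  move=> /(_ _ (nbhs c) (fun x y => `|s x y - s c y| < e /\ `|s y x - s y c| < e)).
  apply => y By.
  (* The sections at [x'] and at [c] are both compared with the value at [(c, y)], each at the cost
     of [e / 2]. *)
  have h1 : \forall p \near (c, y), `|s c y - s p.1 p.2| < e / 2.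
    by have /cvgrPdist_lt := hs (c, y); apply; rewrite divr_gt0.
  have h2 : \forall p \near (y, c), `|s y c - s p.1 p.2| < e / 2.
    by have /cvgrPdist_lt := hs (y, c); apply; rewrite divr_gt0.
  case: h1 => -[/= U1 V1] [U1c V1y] UV1; case: h2 => -[/= V2 U2] [V2y U2c] UV2.
  exists (V1 `&` V2, U1 `&` U2) => /=; first by split; exact: filterI.
  have U1c' := nbhs_singleton U1c; have U2c' := nbhs_singleton U2c.
  move=> [y' x'] /= [[V1y' V2y'] [U1x' U2x']].
  have a1 := UV1 (x', y') (conj U1x' V1y').
  have a2 := UV1 (c, y') (conj U1c' V1y').
  have b1 := UV2 (y', x') (conj V2y' U2x').
  have b2 := UV2 (y', c) (conj V2y' U2c').
  rewrite /= in a1 a2 b1 b2; move: a1 a2 b1 b2; rewrite !ltr_distl.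
  by move=> /andP[? ?] /andP[? ?] /andP[? ?] /andP[? ?]; split;
    apply/andP; split; lra.
(* A finite subcover is extracted along the filter of finite subsets of [A]. *)
pose F : set_system (seq P) := fun G => exists l0 : seq P,
  (forall x, x \in l0 -> A x) /\
  forall l, (forall x, x \in l -> A x) -> {subset l0 <= l} -> G l.
have FF : Filter F.
  split.
  - by exists [::]; split.
  - move=> G H [l [lA lG]] [k [kA kH]]; exists (l ++ k); split.
      by move=> x; rewrite mem_cat => /orP[/lA|/kA].
    move=> u uA us; split; [apply: lG => //|apply: kH => //] => x xl;
      by apply: us; rewrite mem_cat xl ?orbT.
  - move=> G H GH [l [lA lG]]; exists l; split => // k kA lk.
    exact/GH/lG.
move/compact_near_coveringP : cA.
move=> /(_ _ F (fun l x => exists2 c, c \in l & close x c) FF) [].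
  move=> x Ax; exists ([set x' | close x' x], [set l | x \in l]) => /=.
    split; first exact: near_close.
    exists [:: x]; split => [y|l _]; first by rewrite inE => /eqP->.
    by apply; rewrite mem_head.
  by move=> [x' l] /= [xx' xl]; exists x.
move=> l [lA lG]; exists l; split => // x Ax.
exact: (lG l lA (fun=> id) x Ax).
Qed.

Section TauTopology.
Context (R : realType) (P : topologicalType) (Y : pointedType).
Context (s : P -> P -> R) (S : set P) (tau : Y -> Y -> R) (f : P -> Y).
Hypothesis s_cont : continuous (fun p : P * P => s p.1 p.2).
Hypothesis s_compact : forall e : R, 0 < e ->
  compact [set p : P * P | [/\ S p.1, S p.2 & e <= s p.1 p.2]].
Hypothesis fE : forall p q, S p -> S q -> tau (f p) (f q) = s p q.
Hypothesis tau_ge0 : forall x y, 0 <= tau x y.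
Hypothesis f_cover : forall y,
  (exists2 p, S p & f p = y) \/ is_spacelike_boundary tau y.
Hypothesis tau_sep : forall x y : Y, x <> y ->
  exists z, tau x z <> tau y z \/ tau z x <> tau z y.

Let K (n : nat) := [set p : P * P | [/\ S p.1, S p.2 & n.+1%:R^-1 <= s p.1 p.2]].
(** The points taking part in a separation of size at least [n.+1%:R^-1]: compact sets increasing in
    [n], whose images under [f] exhaust all of [Y] but the boundary. *)
Let A n := fst @` K n `|` snd @` K n.

Let A_compact n : compact (A n).
Proof.
have cK : compact (K n) by apply: s_compact; rewrite invr_gt0.
by apply: compactU; apply: continuous_compact => //;
  apply: continuous_subspaceT => p; [exact: cvg_fst|exact: cvg_snd].
Qed.

Let AS n : A n `<=` S.
Proof. by move=> x [[[a b] [/= Sa Sb _] <-]|[[a b] [/= Sa Sb _] <-]]. Qed.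

Let K_mono n m : (n <= m)%N -> K n `<=` K m.
Proof.
move=> nm p [p1 p2 p3]; split => //; apply: le_trans p3.
by rewrite lef_pV2 ?posrE// ler_nat.
Qed.

Let A_mono n m : (n <= m)%N -> A n `<=` A m.
Proof.
by move=> /K_mono h x [[p /h Kp <-]|[p /h Kp <-]]; [left|right]; exists p.
Qed.

Let s_A p q : S p -> S q -> 0 < s p q -> exists n, A n p /\ A n q.
Proof.
move=> Sp Sq s0; have [n ns] : exists n, n.+1%:R^-1 <= s p q.
  exists (Num.truncn (s p q)^-1).
  rewrite -[leRHS]invrK lef_pV2 ?posrE ?invr_gt0//.
  by apply: ltW; rewrite truncnS_gt.
by exists n; split; [left|right]; exists (p, q).
Qed.

Let A_cover y : is_spacelike_boundary tau y \/
  exists n, forall m, (n <= m)%N -> exists2 p, A m p & f p = y.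
Proof.
have [[p Sp <-]|] := f_cover y; last by left.
have [h|/existsNP[y' h]] := pselect (is_spacelike_boundary tau (f p));
  first by left.
have [[q Sq qy']|b] := f_cover y'; last first.
  by exfalso; apply: h; have [-> ->] := b (f p).
right; suff [n [An _]] : exists n, A n p /\ A n q.
  by exists n => m nm; exists p => //; exact: A_mono An.
move: h; rewrite -qy' !fE// => h.
have [s0|s0] := ltP 0 (s p q); first exact: s_A.
have [s1|s1] := ltP 0 (s q p).
  by have [n [? ?]] := s_A Sq Sp s1; exists n.
exfalso; apply: h; split; apply/eqP; rewrite eq_le ?s0 ?s1/= -?fE ?tau_ge0//.
Qed.

(* A countable family that is uniformly dense, in the sense of its time
   separations to compact sets; this is where second countability comes from. *)
Let approx_family : exists d : nat -> Y, forall n m x (e : R), 0 < e -> A n x ->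
  exists k c, [/\ S c, d k = f c & forall y, A m y ->
    `|s x y - s c y| < e /\ `|s y x - s y c| < e].
Proof.
have /choice[l lP] (i : nat * nat * nat) : exists l : seq P,
    (forall x, x \in l -> A i.1.1 x) /\
    forall x, A i.1.1 x -> exists2 c, c \in l &
      forall y, A i.1.2 y -> `|s x y - s c y| < i.2.+1%:R^-1 /\
                             `|s y x - s y c| < i.2.+1%:R^-1.
  by apply: uniform_sections => //; rewrite invr_gt0.
exists (fun k => if choice.unpickle k is Some (i, j)
                 then nth point (map f (l i)) j else point).
move=> n m x e e0 Ax; have [k ke] : exists k : nat, k.+1%:R^-1 < e.
  exists (Num.truncn e^-1).
  by rewrite -[ltRHS]invrK ltf_pV2 ?posrE ?invr_gt0// truncnS_gt.
have [lA lx] := lP (n, m, k); have [c cl cP] := lx x Ax.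
exists (choice.pickle ((n, m, k), index c (l (n, m, k)))), c; split.
- exact: (AS (lA _ cl)).
- by rewrite choice.pickleK (nth_map c) ?index_mem// nth_index.
- by move=> y /cP [? ?]; split; apply: lt_trans ke.
Qed.

(** The sections at the [d k] approximate all others uniformly on the sets [A m], so they inherit
    the separation of points and their initial topology is Hausdorff. Compact sets are then closed,
    and continuity of [tau] splits into two semicontinuities. The upper one holds because superlevel
    sets are images of compact sets. For the lower one, pairs near a point of positive separation
    are first confined to a compact set, in which sublevel sets are closed. *)
Lemma tau_topology_exists : exists d : nat -> Y,
  (forall x y, (forall j, tau_sections tau d j x = tau_sections tau d j y) ->
     x = y) /\
  tau_topology tau (init_topology (tau_sections tau d)).
Proof.
have [d dP] := approx_family; exists d.
have approx z x y e : 0 < e -> ~ is_spacelike_boundary tau z ->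
    exists k, [/\ `|tau x (d k) - tau x z| < e, `|tau y (d k) - tau y z| < e,
      `|tau (d k) x - tau z x| < e & `|tau (d k) y - tau z y| < e].
  move=> e0 nz; have [//|[n nzP]] := A_cover z.
  have [p Ap pz] := nzP n (leqnn n).
  (* One [m] serves both [x] and [y]; a boundary point needs none, as its separations are zero. *)
  have [m mP] : exists m, forall w, w = x \/ w = y ->
      is_spacelike_boundary tau w \/ exists2 q, A m q & f q = w.
    have [bx|[nx nxP]] := A_cover x; have [by_|[ny nyP]] := A_cover y.
    - by exists 0 => w [->|->]; left.
    - by exists ny => w [->|->]; [left|right; exact: nyP].
    - by exists nx => w [->|->]; [right; exact: nxP|left].
    - exists (maxn nx ny) => w [->|->]; right.
        by apply: nxP; rewrite leq_maxl.
      by apply: nyP; rewrite leq_maxr.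
  have [k [c [Sc dk cP]]] := dP n m p e e0 Ap.
  have h w : w = x \/ w = y ->
      `|tau w (d k) - tau w z| < e /\ `|tau (d k) w - tau z w| < e.
    move=> /mP[b|[q Aq <-]].
      by rewrite !(b _).1 !(b _).2 subrr normr0.
    rewrite dk -pz !fE//; try exact: AS Ap; try exact: AS Aq.
    by have [? ?] := cP q Aq; split; rewrite distrC.
  exists k.
  have [? ?] := h x (or_introl erefl); have [? ?] := h y (or_intror erefl).
  by split.
set g := tau_sections tau d.
have sep x y : (forall j, g j x = g j y) -> x = y.
  move=> hg; apply: contrapT => /tau_sep[z zP].
  have nz : ~ is_spacelike_boundary tau z.
    by move=> b; case: zP; rewrite ?(b x).1 ?(b y).1 ?(b x).2 ?(b y).2.
  have hk k : tau x (d k) = tau y (d k) /\ tau (d k) x = tau (d k) y.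
    by split; [exact: (hg (k, false))|exact: (hg (k, true))].
  (* Half the larger gap. The separations of [x] and [y] with [d k] coincide and lie within [e] of
     those with [z], which would force this gap below [2 * e]. *)
  pose e := Num.max `|tau x z - tau y z| `|tau z x - tau z y| / 2.
  have e0 : 0 < e.
    rewrite divr_gt0// lt_max !normr_gt0 !subr_eq0.
    by case: zP => /eqP ->; rewrite ?orbT.
  have [k [h1 h2 h3 h4]] := approx z x y e e0 nz.
  have [k1 k2] := hk k; rewrite k1 in h1; rewrite k2 in h3.
  have /orP[he|he] : (`|tau x z - tau y z| == 2 * e) || (`|tau z x - tau z y| == 2 * e).
    rewrite /e mulrC divfK// /Num.max; case: ifP => _; by rewrite eqxx ?orbT.
  - have := ler_distD (tau y (d k)) (tau x z) (tau y z).
    by rewrite (eqP he) [`|tau x z - _|]distrC; lra.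
  - have := ler_distD (tau (d k) y) (tau z x) (tau z y).
    by rewrite (eqP he) [`|tau z x - _|]distrC; lra.
split => //.
set Z := top_space (init_topology g).
have hZ : hausdorff_space Z by exact: init_hausdorff.
(* Only relative continuity on [S] is available, since [fE] ties [tau] to [s] on [S] alone. *)
have f_cvg p : S p -> f q @[q --> within S (nbhs p)] --> (f p : Z).
  move=> Sp; apply: cvg_init => -[k b]; rewrite /g/tau_sections/=.
  have [[c Sc <-]|bd] := f_cover (d k); last first.
    case: b.
      rewrite (_ : (fun t => tau (d k) (f t)) = cst 0) ?(bd _).1; first exact: cvg_cst.
      by apply/funext => q /=; rewrite (bd _).1.
    rewrite (_ : (fun t => tau (f t) (d k)) = cst 0) ?(bd _).2; first exact: cvg_cst.
    by apply/funext => q /=; rewrite (bd _).2.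
  have : (if b then s c else s^~ c) q @[q --> within S (nbhs p)] -->
      (if b then s c p else s p c).
    apply: cvg_within_filter; have [h1 h2] := continuous_sections s_cont.
    by case: b; [exact: h1|exact: h2].
  case: b => h.
    rewrite fE//; apply: cvg_trans h; apply: near_eq_cvg.
    by near=> q => /=; rewrite fE//; near: q; exact: withinT.
  rewrite fE//; apply: cvg_trans h; apply: near_eq_cvg.
  by near=> q => /=; rewrite fE//; near: q; exact: withinT.
pose ff (p : P * P) : Z * Z := (f p.1, f p.2).
have ff_compact (C : set (P * P)) : C `<=` S `*` S -> compact C ->
    compact (ff @` C).
  move=> CS cC; apply: continuous_compact => //.
  apply/subspace_continuousP => -[p q] Cpq; have [/= Sp Sq] := CS _ Cpq.
  apply: (cvg_pair (f := fun z : P * P => f z.1 : Z) (g := fun z : P * P => f z.2 : Z)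
    (G := nbhs (f p : Z)) (H := nbhs (f q : Z))).
    apply: (@cvg_comp _ _ _ fst f _ (within S (nbhs p))); last exact: f_cvg.
    move=> U nU; have : nbhs (p, q) (fst @^-1` [set u | S u -> U u]) by exact: cvg_fst.
    by apply: filterS => z h Cz; apply: h; exact: (CS _ Cz).1.
  apply: (@cvg_comp _ _ _ snd f _ (within S (nbhs q))); last exact: f_cvg.
  move=> U nU; have : nbhs (p, q) (snd @^-1` [set u | S u -> U u]) by exact: cvg_snd.
  by apply: filterS => z h Cz; apply: h; exact: (CS _ Cz).2.
have lev_compact e : 0 < e -> compact [set p : Z * Z | e <= tau p.1 p.2].
  move=> e0; rewrite (_ : [set p : Z * Z | _] =
    ff @` [set p : P * P | [/\ S p.1, S p.2 & e <= s p.1 p.2]]).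
    by apply: ff_compact; [move=> p []|exact: s_compact].
  apply/seteqP; split=> [[x y]/= exy|_ [[p q] /= [Sp Sq epq] <-]]; last first.
    by rewrite /= fE.
  have [[p Sp px]|b] := f_cover x; last by move: exy; rewrite (b y).1; lra.
  have [[q Sq qy]|b] := f_cover y; last by move: exy; rewrite (b x).2; lra.
  by exists (p, q); rewrite /ff /= ?px ?qy//; split => //; rewrite -fE// px qy.
split => // -[x y].
have hZZ := hausdorff_prod hZ hZ.
have upper c : tau x y < c -> \forall p \near ((x, y) : Z * Z), tau p.1 p.2 < c.
  move=> xyc; have c0 : 0 < c by apply: le_lt_trans xyc.
  have nxy : ~ [set p : Z * Z | c <= tau p.1 p.2] (x, y).
    by move=> /=; apply/negP; rewrite -ltNge.
  have := setC_nbhs (compact_closed hZZ (lev_compact c c0)) nxy.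
  apply: filterS.
  by move=> p /= /negP; rewrite -ltNge.
have lower c : c < tau x y -> \forall p \near ((x, y) : Z * Z), c < tau p.1 p.2.
  move=> cxy; have [c0|c0] := ltP c 0.
    by near=> p; apply: lt_le_trans (tau_ge0 _ _).
  have t0 : 0 < tau x y by lra.
  pose t := tau x y / 2.
  have nb : ~ is_spacelike_boundary tau x /\ ~ is_spacelike_boundary tau y.
    by split => b; move: t0; rewrite ?(b y).1 ?(b x).2 ltxx.
  have t0' : 0 < t by rewrite divr_gt0.
  (* [d k1] replaces [x] and [d k2] replaces [y]. An error below half of [tau x y] keeps both
     separations positive, and being sections of the family they stay bounded below near [y] and
     [x]. *)
  have [k1 [_ _ _]] := approx x y y t t0' nb.1; rewrite ltr_distl => /andP[xk1 _].
  have [k2 [+ _ _ _]] := approx y x x t t0' nb.2; rewrite ltr_distl => /andP[xk2 _].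
  have {}xk1 : 0 < tau (d k1) y by move: xk1; rewrite /t; lra.
  have {}xk2 : 0 < tau x (d k2) by move: xk2; rewrite /t; lra.
  have A_of n u v : n.+1%:R^-1 <= tau u v ->
      (exists2 p, A n p & f p = u) /\ (exists2 p, A n p & f p = v).
    move=> nuv; have n0 : 0 < n.+1%:R^-1 :> R by rewrite invr_gt0.
    have [[p Sp pu]|b] := f_cover u; last by move: nuv; rewrite (b _).1 leNgt n0.
    have [[q Sq qv]|b] := f_cover v; last by move: nuv; rewrite (b _).2 leNgt n0.
    have Kpq : K n (p, q) by split => //=; rewrite -fE// pu qv.
    by split; [exists p|exists q] => //; [left|right]; exists (p, q).
  have [n ne] : exists n, n.+1%:R^-1 < Num.min (tau (d k1) y) (tau x (d k2)).
    exists (Num.truncn (Num.min (tau (d k1) y) (tau x (d k2)))^-1).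
    rewrite -[ltRHS]invrK ltf_pV2 ?posrE ?invr_gt0// ?lt_min ?xk1//.
    exact: truncnS_gt.
  move: ne; rewrite lt_min => /andP[ny nx].
  have nU : \forall u \near (x : Z), n.+1%:R^-1 < tau u (d k2).
    exact: (cvgr_gt _ (@init_continuous _ _ _ g (k2, false) x) _ nx).
  have nV : \forall v \near (y : Z), n.+1%:R^-1 < tau (d k1) v.
    exact: (cvgr_gt _ (@init_continuous _ _ _ g (k1, true) y) _ ny).
  (* A compact, hence closed, set that contains every pair close to [(x, y)] whose separation is at
     most [c], but not [(x, y)]. *)
  pose D := ff @` [set p : P * P | (A n `*` A n) p /\ s p.1 p.2 <= c].
  have cD : closed D.
    apply: compact_closed => //; apply: ff_compact.
      by move=> p [[/= /AS ? /AS ?] _].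
    have -> : [set p : P * P | (A n `*` A n) p /\ s p.1 p.2 <= c] =
      (A n `*` A n) `&` ((fun p => s p.1 p.2) @^-1` [set z | z <= c]) by [].
    apply: compact_closedI; first exact: compact_setX.
    by apply: closed_comp => [p _|]; [exact: s_cont|exact: closed_le].
  have nD : ~ D (x, y).
    move=> [[p q] [[/= /AS Sp /AS Sq] sc] [px qy]].
    by move: cxy; rewrite -px -qy fE//; lra.
  have nUV : \forall p \near ((x, y) : Z * Z),
      n.+1%:R^-1 < tau p.1 (d k2) /\ n.+1%:R^-1 < tau (d k1) p.2.
    by exists ([set u | n.+1%:R^-1 < tau u (d k2)],
               [set v | n.+1%:R^-1 < tau (d k1) v]).
  apply: filterS2 (setC_nbhs cD nD) nUV => -[u v] /= nDuv [nu nv].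
  rewrite ltNge; apply/negP => uvc; apply: nDuv.
  have [[p Ap pu] _] := A_of _ _ _ (ltW nu).
  have [_ [q Aq qv]] := A_of _ _ _ (ltW nv).
  exists (p, q); rewrite /ff /= ?pu ?qv//; split => //=.
  by rewrite -fE ?pu ?qv//; [exact: AS Ap|exact: AS Aq].
apply/(@cvgrPdist_lt _ _ _ _ (nbhs_filter ((x, y) : Z * Z))) => e e0.
have h1 := upper (tau x y + e) _; have h2 := lower (tau x y - e) _.
apply: filterS2 (h1 _) (h2 _); try lra.
move=> p p1 p2 /=; rewrite ltr_distl; apply/andP; split; lra.
Unshelve. all: by end_near.
Qed.

End TauTopology.

Lemma topology_eq (X : Type) (T T' : topology X) : opens T = opens T' -> T = T'.
Proof.
case: T T' => [p1 p2 p3 p4] [q1 q2 q3 q4] /= e; subst q1.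
by congr Topology; exact: Prop_irrelevance.
Qed.

(** Every admissible topology makes the sections continuous and so contains their initial topology,
    which is itself a member of the intersection. *)
Lemma tau_topology_coarsest (R : realType) (X : pointedType) (tau : X -> X -> R)
    (d : nat -> X) :
  tau_topology tau (init_topology (tau_sections tau d)) ->
  coarsest_topology tau = init_topology (tau_sections tau d).
Proof.
move=> hT; apply: topology_eq; apply/seteqP; split=> [U hU|U oU].
  exact: (hU _ hT).
rewrite /coarsest_topology/= => T [hc _].
apply: (init_coarsest (g := tau_sections tau d)) oU => -[k b].
have [h1 h2] := continuous_sections hc.
by case: b; [exact: h1|exact: h2].
Qed.

(** * Properties of the coarsest admissible topology *)

Section LorentzianTopology.
Context (R : realType) (X : pointedType) (tau : X -> X -> R).
Hypothesis tauP : is_blms tau.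

Let tau_ge0 := blms_ge0 tauP.

Lemma blms_dense : exists d : nat -> X,
  [/\ (forall x y, (forall j, tau_sections tau d j x = tau_sections tau d j y) ->
         x = y),
      tau_topology tau (coarsest_topology tau) &
      coarsest_topology tau = init_topology (tau_sections tau d)].
Proof.
have [T [hc hk]] := blms_topology tauP.
have [||||||d [dsep dT]] := @tau_topology_exists R (top_space T) X tau setT tau id.
- exact: hc.
- move=> e e0; have := hk e e0; congr (compact _).
  by apply/seteqP; split=> [p ?|p []].
- by [].
- exact: tau_ge0.
- by move=> y; left; exists y.
- exact: blms_separation tauP.
by exists d; have e := tau_topology_coarsest dT; split => //; rewrite e.
Qed.

Lemma blms_tau_topology : tau_topology tau (coarsest_topology tau).
Proof. by have [d []] := blms_dense. Qed.

Lemma blms_continuous :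
  continuous (fun p : lspace tau * lspace tau => tau p.1 p.2).
Proof. exact: blms_tau_topology.1. Qed.

Lemma blms_compact (e : R) : 0 < e ->
  compact [set p : lspace tau * lspace tau | e <= tau p.1 p.2].
Proof. exact: blms_tau_topology.2. Qed.

Lemma blms_continuousl (z : X) : continuous (tau z : lspace tau -> R).
Proof. exact: (continuous_sections blms_continuous).1. Qed.

Lemma blms_continuousr (z : X) : continuous (tau^~ z : lspace tau -> R).
Proof. exact: (continuous_sections blms_continuous).2. Qed.

Lemma cvg_lspace (T : Type) (F : set_system T) (FF : Filter F)
    (h : T -> lspace tau) (x : lspace tau) :
  (forall z, tau z (h t) @[t --> F] --> tau z x) ->
  (forall z, tau (h t) z @[t --> F] --> tau x z) -> h t @[t --> F] --> x.
Proof.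
have [d [_ _ e]] := blms_dense => h1 h2; move: h x h1 h2; rewrite e => h x h1 h2.
by apply: cvg_init => -[k []]; [exact: h1|exact: h2].
Qed.

Lemma blms_boundary_unique (x y : X) :
  is_spacelike_boundary tau x -> is_spacelike_boundary tau y -> x = y.
Proof.
move=> bx by_; apply: contrapT => /(blms_separation tauP)[z].
by rewrite (bx z).1 (bx z).2 (by_ z).1 (by_ z).2; case.
Qed.

Lemma blms_nonboundary (x : X) : ~ is_spacelike_boundary tau x ->
  exists z, 0 < tau x z \/ 0 < tau z x.
Proof.
move=> /existsNP[z nz]; exists z; rewrite !lt0r !tau_ge0 !andbT.
have [x0|] := eqVneq (tau x z) 0; last by left.
by right; apply/eqP => z0; apply: nz.
Qed.

(** The projections of the superlevel sets at [n.+1%:R^-1] catch every point having a positive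
    separation; what remains is at most the single boundary point. *)
Lemma blms_sigma_compact : exists C : nat -> set (lspace tau),
  (forall n, compact (C n)) /\ \bigcup_n C n = setT.
Proof.
pose K (n : nat) :=
  [set p : lspace tau * lspace tau | n.+1%:R^-1 <= tau p.1 p.2].
have cK n : compact (K n) by apply: blms_compact; rewrite invr_gt0.
exists (fun n => if n is m.+1 then fst @` K m `|` snd @` K m
                 else [set x : lspace tau | is_spacelike_boundary tau x]).
split=> [[|m]|].
- have [[x bx]|h] := pselect (exists x, is_spacelike_boundary tau x).
    rewrite (_ : [set _ | _] = [set (x : lspace tau)]).
      exact: compact_set1.
    apply/seteqP; split=> [y by_|y ->//].
    exact: blms_boundary_unique.
  rewrite (_ : [set _ | _] = set0); first exact: compact0.
  by apply/seteqP; split => // y by_; apply: h; exists y.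
- by apply: compactU; apply: continuous_compact => //;
    apply: continuous_subspaceT => p; [exact: cvg_fst|exact: cvg_snd].
apply/seteqP; split => // x _.
have [b|/blms_nonboundary[z zP]] := pselect (is_spacelike_boundary tau x).
  by exists 0.
have arch (t : R) : 0 < t -> exists n : nat, n.+1%:R^-1 <= t.
  move=> t0; exists (Num.truncn t^-1).
  by rewrite -[leRHS]invrK lef_pV2 ?posrE ?invr_gt0// ltW// truncnS_gt.
case: zP => /arch[n h]; exists n.+1 => //=.
  by left; exists (x, z).
by right; exists (z, x).
Qed.

Lemma blms_tame : tame_space (lspace tau).
Proof.
have [d [dsep _ e]] := blms_dense; have sc := blms_sigma_compact.
by move: sc; rewrite e => sc; exact: init_tame.
Qed.

End LorentzianTopology.

(** * Borel probability measures *)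

Section BorelProbability.
Context (R : realType) (T : ptopologicalType) (m : probability (borel T) R).

Lemma borel_open (U : set T) : open U -> measurable (U : set (borel T)).
Proof. by move=> oU; exact: sub_sigma_algebra. Qed.

Lemma borel_closed (F : set T) : closed F -> measurable (F : set (borel T)).
Proof.
move=> cF; rewrite -[F]setCK; apply: measurableC; apply: borel_open.
exact: closed_openC.
Qed.

Definition support : set T :=
  [set x | forall U : set T, open U -> U x -> (0 < m U)%E].

Lemma support_closed : closed support.
Proof.
rewrite -[support]setCK; apply: open_closedC.
rewrite openE => x /existsNP[U /not_implyP[oU /not_implyP[Ux mU]]].
apply: filterS (open_nbhs_nbhs (conj oU Ux)).
by move=> y Uy /(_ U oU Uy).
Qed.

Lemma measure_setC_support : (exists B : nat -> set T, (forall n, open (B n)) /\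
    forall (U : set T) x, open U -> U x -> exists n, B n x /\ B n `<=` U) ->
  m (~` support) = 0%E.
Proof.
move=> [B [oB bB]].
have mC : measurable (~` support : set (borel T)).
  by apply: measurableC; apply: borel_closed; exact: support_closed.
apply/negligibleP => //.
pose N n := if (0 < m (B n))%E then set0 else B n.
have NP n : m.-negligible (N n).
  rewrite /N; case: ifPn => [_|]; first exact: negligible_set0.
  rewrite -leNgt => mB; apply/negligibleP; first exact: borel_open.
  by apply/eqP; rewrite eq_le mB measure_ge0.
apply: negligibleS (negligible_bigcup NP).
move=> x /existsNP[U /not_implyP[oU /not_implyP[Ux /negP mU]]].
have [n [Bx BU]] := bB U x oU Ux.
exists n => //; rewrite /N ifN// -leNgt; apply: (@le_trans _ _ (m U)).
  by apply: le_measure => //; rewrite inE; exact: borel_open.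
by rewrite leNgt.
Qed.

Lemma measure_setD_bigcup_lt (V : set (borel T)) (F : nat -> set (borel T))
    (e : \bar R) :
  measurable V -> (forall n, measurable (F n)) ->
  (m (V `\` \bigcup_n F n) < e)%E ->
  exists N, (m (V `\` \big[setU/set0]_(i < N) F i) < e)%E.
Proof.
move=> mV mF me; pose D N := V `\` \big[setU/set0]_(i < N) F i.
have DE : \bigcap_n D n = V `\` \bigcup_n F n.
  rewrite /D; apply/seteqP; split=> [x Dx|x [Vx nF] N _].
    split; first exact: (Dx 0 I).1.
    move=> [n _ Fx]; have [_] := Dx n.+1 I; apply.
    by rewrite big_ord_recr/=; right.
  split => //; rewrite -bigcup_mkord => -[n _ Fx]; apply: nF.
  by exists n.
have mD n : measurable (D n).
  by apply: measurableD => //; apply: bigsetU_measurable.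
have h : m (D N) @[N --> \oo] --> m (\bigcap_n D n).
  apply: nonincreasing_cvg_mu => //.
  - apply: le_lt_trans (ltey 1); exact: probability_le1.
  - exact: bigcap_measurable.
  - move=> i j ij; apply/subsetPset => x [Vx nF]; split => // Fx; apply: nF.
    exact: subset_bigsetU Fx.
rewrite -DE in me.
have [N _ NP] := h _ (open_nbhs_nbhs (conj (@open_ereal_lt_ereal _ _) me)).
by exists N; exact: (NP N (leqnn N)).
Qed.

Hypothesis tT : tame_space T.

(** The sets with this property form a sigma-algebra. It contains the open sets because the network
    writes each of them as a countable union of closed sets. *)
Lemma measure_closed_open_regular (A : set (borel T)) (e : R) :
  measurable A -> 0 < e ->
  exists F U : set T, [/\ closed F, open U, F `<=` A, A `<=` U &
    (m (U `\` F) < e%:E)%E].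
Proof.
move=> mA; move: A mA e.
pose reg (A : set (borel T)) := forall e : R, 0 < e ->
  exists F U : set T, [/\ closed F, open U, F `<=` A, A `<=` U &
    (m (U `\` F) < e%:E)%E].
suff : measurable `<=` reg by [].
apply: smallest_sub; last first.
  move=> U oU e e0; have [G [cG bG]] := tame_network tT.
  pose F n : set T := if `[< G n `<=` U >] then G n else set0.
  have cF n : closed (F n).
    by rewrite /F; case: ifP => _; [exact: cG|exact: closed0].
  have UE : \bigcup_n F n = U.
    apply/seteqP; split=> [x [n _]|x Ux].
      by rewrite /F; case: asboolP => // GU /GU.
    by have [n [Gx GU]] := bG U x oU Ux; exists n => //; rewrite /F asboolT.
  have [||| N NP] := @measure_setD_bigcup_lt U F e%:E.
  - exact: borel_open.
  - by move=> n; exact: borel_closed.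
  - by rewrite UE setDv measure0 lte_fin.
  exists (\big[setU/set0]_(i < N) F i), U; split => //.
    by apply: closed_bigsetU => i _; exact: cF.
  by rewrite -bigcup_mkord => x [i _ Fx]; rewrite -UE; exists i.
split.
- move=> e e0; exists set0, set0; split => //; [exact: closed0|exact: open0|].
  by rewrite setD0 measure0 lte_fin.
- move=> A rA e e0; have [F [U [cF oU FA AU mUF]]] := rA e e0.
  exists (~` U), (~` F); split; [exact: open_closedC|exact: closed_openC| | |].
  + by move=> x nU; split => // /AU.
  + by move=> x [_ nA] /FA.
  + by rewrite setDE setCK setIC -setDE.
- move=> A rA e e0.
  (* The errors add up to [e / 2] only: the strict inequality must survive the passage from all
     [F n] to finitely many, whose union is closed. *)
  have /choice[FU FUP] n : exists FU : set T * set T, [/\ closed FU.1, open FU.2,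
      FU.1 `<=` A n, A n `<=` FU.2 &
      (m (FU.2 `\` FU.1) < (e / 2 / (2 ^ n.+1)%:R)%:E)%E].
    have [|F [U ?]] := rA n (e / 2 / (2 ^ n.+1)%:R); last by exists (F, U).
    by rewrite !divr_gt0// ltr0n expn_gt0.
  pose F n := (FU n).1; pose U := \bigcup_n (FU n).2.
  have oU : open U by apply: bigcup_open => n _; have [] := FUP n.
  have mF n : measurable (F n : set (borel T)).
    by apply: borel_closed; have [] := FUP n.
  have mU n : measurable ((FU n).2 : set (borel T)).
    by apply: borel_open; have [] := FUP n.
  have [||| N NP] := @measure_setD_bigcup_lt U F e%:E.
  + exact: borel_open.
  + exact: mF.
  + apply: (@le_lt_trans _ _ (e / 2)%:E); last by rewrite lte_fin; lra.
    apply: (@le_trans _ _ (\sum_(0 <= n <oo) m ((FU n).2 `\` F n))%E).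
      apply: measure_sigma_subadditive.
      - by move=> n; exact: measurableD.
      - by apply: measurableD; [exact: borel_open|exact: bigcup_measurable].
      - move=> x [[n _ Ux] nF]; exists n => //; split => // Fx; apply: nF.
        by exists n.
    apply: (@le_trans _ _ (\sum_(0 <= n <oo) (0 + (e / 2 / (2 ^ n.+1)%:R)%:E))%E).
      apply: lee_nneseries => [n *|n *]; first exact: measure_ge0.
      by rewrite add0e; apply: ltW; have [] := FUP n.
    apply: (le_trans (epsilon_trick xpredT _ _)) => //.
      by rewrite divr_ge0// ltW.
    by rewrite eseries0// add0e.
  exists (\big[setU/set0]_(i < N) F i), U; split => //.
  + by apply: closed_bigsetU => i _; have [] := FUP i.
  + rewrite -bigcup_mkord => x [i _ Fx]; exists i => //.
    by have [_ _ h _ _] := FUP i; exact: h.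
  + move=> x [i _ Ax]; exists i => //.
    by have [_ _ _ h _] := FUP i; exact: h.
Qed.

Lemma measure_outer_regular (A : set (borel T)) (e : R) :
  measurable A -> 0 < e ->
  exists U : set T, [/\ open U, A `<=` U & (m (U `\` A) < e%:E)%E].
Proof.
move=> mA e0; have [F [U [cF oU FA AU mUF]]] := measure_closed_open_regular mA e0.
exists U; split => //; apply: le_lt_trans mUF.
apply: le_measure; rewrite ?inE; try exact: setDS.
  by apply: measurableD => //; exact: borel_open.
by apply: measurableD; [exact: borel_open|exact: borel_closed].
Qed.

Lemma measure_inner_compact (A : set (borel T)) (e : R) :
  measurable A -> 0 < e ->
  exists K : set T, [/\ compact K, K `<=` A & (m (A `\` K) < e%:E)%E].
Proof.
move=> mA e0; have e20 : 0 < e / 2 by rewrite divr_gt0.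
have [F [U [cF oU FA AU mUF]]] := measure_closed_open_regular mA e20.
have [C [cC CT]] := tame_sigma_compact tT.
have cFC n : compact (F `&` C n).
  by rewrite setIC; exact: compact_closedI.
have mFC n : measurable (F `&` C n : set (borel T)).
  by apply: borel_closed; apply: compact_closed => //; exact: tame_hausdorff.
have mF : measurable (F : set (borel T)) by exact: borel_closed.
have [||| N NP] := @measure_setD_bigcup_lt F (fun n => F `&` C n) (e / 2)%:E => //.
  by rewrite -setI_bigcupr CT setIT setDv measure0 lte_fin.
have mK : measurable (\big[setU/set0]_(i < N) (F `&` C i) : set (borel T)).
  exact: bigsetU_measurable.
have mUFm : measurable (U `\` F : set (borel T)).
  by apply: measurableD => //; exact: borel_open.
exists (\big[setU/set0]_(i < N) (F `&` C i)); split.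
- by apply: bigsetU_compact => i _; exact: cFC.
- by rewrite -(bigcup_mkord N (fun i => F `&` C i)) => x [i _ [/FA]].
apply: (@le_lt_trans _ _ (m ((U `\` F) `|`
    (F `\` \big[setU/set0]_(i < N) (F `&` C i))))).
  apply: le_measure; rewrite ?inE.
  - exact: measurableD.
  - by apply: measurableU => //; exact: measurableD.
  - move=> x [Ax nK]; have [Fx|nF] := pselect (F x); first by right.
    by left; split => //; exact: AU.
apply: (le_lt_trans (measureU2 _ _ _)) => //; first exact: measurableD.
rewrite [e](_ : e = e / 2 + e / 2); last by lra.
by rewrite EFinD lteD.
Qed.

End BorelProbability.

(** * Gluing *)

Lemma probability_of_measure d (T : measurableType d) (R : realType)
    (mu : set T -> \bar R) :
  mu set0 = 0%E -> (forall A, 0 <= mu A)%E -> semi_sigma_additive mu ->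
  mu setT = 1%E -> exists P : probability T R, forall A, P A = mu A.
Proof.
move=> h0 hge hadd hT.
pose M : {measure set T -> \bar R} :=
  HB.pack mu (isMeasure.Build _ _ _ mu h0 hge hadd).
pose P : probability T R :=
  HB.pack mu M (Measure_isProbability.Build _ _ _ M hT).
by exists P.
Qed.

(** An alias of the product, so that the semiring of rectangles does not clash with the product
    sigma-algebra; the display is opaque for the same reason. *)
Definition rect_type (T1 T2 : Type) : Type := (T1 * T2)%type.

Definition rect_display : measure_display * measure_display -> measure_display.
Proof. by case. Qed.

Section RectangleSemiring.
Context (d1 d2 : measure_display) (T1 : measurableType d1) (T2 : measurableType d2).

Definition rectangles : set (set (rect_type T1 T2)) :=
  [set A | exists A1 A2, [/\ measurable A1, measurable A2 & A = A1 `*` A2]].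

Let rectangles0 : rectangles set0.
Proof. by exists set0, set0; split => //; rewrite setX0. Qed.

Let rectanglesI : setI_closed rectangles.
Proof.
move=> _ _ [A1 [A2 [mA1 mA2 ->]]] [B1 [B2 [mB1 mB2 ->]]].
exists (A1 `&` B1), (A2 `&` B2); split; try exact: measurableI.
by rewrite setXI.
Qed.

Let rectanglesD : semi_setD_closed rectangles.
Proof.
move=> _ _ [A1 [A2 [mA1 mA2 ->]]] [B1 [B2 [mB1 mB2 ->]]].
exists [set (A1 `\` B1) `*` A2; (A1 `&` B1) `*` (A2 `\` B2)]; split.
- exact: finite_set2.
- move=> _ [->|->].
    by exists (A1 `\` B1), A2; split => //; exact: measurableD.
  exists (A1 `&` B1), (A2 `\` B2); split => //.
    exact: measurableI.
  exact: measurableD.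
- apply/seteqP; split=> [[x y] [[/= A1x A2y] nB]|[x y] [_ [->|->] /=]].
  + have [B1x|nB1x] := pselect (B1 x).
      exists ((A1 `&` B1) `*` (A2 `\` B2)); first by right.
      by split => //=; split => // B2y; apply: nB.
    by exists ((A1 `\` B1) `*` A2); [left|split].
  + by move=> [[A1x nB1x] A2y]; split => //= -[].
  + by move=> [[A1x B1x] [A2y nB2y]]; split => //= -[].
- by move=> _ _ [->|->] [->|->] [[x y]] [[/= [? ?] ?] [/= [? ?] ?]].
Qed.

HB.instance Definition _ := Pointed.on (rect_type T1 T2).
HB.instance Definition _ := @isSemiRingOfSets.Build (rect_display (d1, d2))
  (rect_type T1 T2) rectangles rectangles0 rectanglesI rectanglesD.

End RectangleSemiring.

(** * From a finitely additive coupling to a measure *)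

Section RectangleExtension.
Context (R : realType) (T1 T2 : ptopologicalType).
Context (m1 : probability (borel T1) R) (m2 : probability (borel T2) R).
Hypotheses (tT1 : tame_space T1) (tT2 : tame_space T2).

Local Notation TT := (borel T1 * borel T2)%type.
Local Notation rT := (rect_type (borel T1) (borel T2)).

Variable mu : set TT -> R.
Hypothesis mu_ge0 : forall A, 0 <= mu A.
Hypothesis mu_additive : forall A B, measurable A -> measurable B ->
  [disjoint A & B] -> mu (A `|` B) = mu A + mu B.
Hypothesis mu_fst : forall A, measurable A -> (mu (A `*` setT))%:E = m1 A.
Hypothesis mu_snd : forall B, measurable B -> (mu (setT `*` B))%:E = m2 B.

Let mu0 : mu set0 = 0.
Proof.
have := @mu_additive set0 set0 measurable0 measurable0.
rewrite setU0 disj_set2E setI0 eqxx => /(_ isT) h; lra.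
Qed.

Let mu_mono A B : measurable A -> measurable B -> A `<=` B -> mu A <= mu B.
Proof.
move=> mA mB AB; rewrite -(setDUK AB) mu_additive ?lerDl//; first exact: measurableD.
by rewrite disj_set2E setDE setICA setICr setI0.
Qed.

Let mu_subadd A B : measurable A -> measurable B -> mu (A `|` B) <= mu A + mu B.
Proof.
move=> mA mB; have -> : A `|` B = A `|` (B `\` A).
  by rewrite setDE setUIr setUCr setIT.
rewrite mu_additive ?lerD2l//.
- by apply: mu_mono => //; exact: measurableD.
- exact: measurableD.
- by rewrite disj_set2E setDE setICA setICr setI0.
Qed.

Let mu_bigsetU (F : nat -> set TT) : (forall k, measurable (F k)) ->
  trivIset setT F -> forall n, mu (\big[setU/set0]_(i < n) F i) = \sum_(i < n) mu (F i).
Proof.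
move=> mF tF; elim=> [|n IH]; first by rewrite !big_ord0.
rewrite !big_ord_recr/= mu_additive ?IH//; first exact: bigsetU_measurable.
rewrite disj_set2E; apply/eqP/seteqP; split => // x [].
rewrite -bigcup_mkord => -[i /= ni Fi] Fn.
have := tF i n I I (ex_intro _ x (conj Fi Fn)) => ii.
by rewrite ii ltnn in ni.
Qed.

Let mu_bigsetU_le (F : nat -> set TT) : (forall k, measurable (F k)) ->
  forall n, mu (\big[setU/set0]_(i < n) F i) <= \sum_(i < n) mu (F i).
Proof.
move=> mF; elim=> [|n IH]; first by rewrite !big_ord0 mu0.
rewrite !big_ord_recr/=; apply: (le_trans (mu_subadd _ _)) => //.
  exact: bigsetU_measurable.
by rewrite lerD2r.
Qed.

Let mu_fst_le A B e : measurable A -> (m1 A < e%:E)%E -> measurable B ->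
  mu (A `*` B) <= e.
Proof.
move=> mA; rewrite -mu_fst// lte_fin => /ltW Ae mB; apply: le_trans Ae.
by apply: mu_mono; [exact: measurableX|exact: measurableX|move=> [x y] []].
Qed.

Let mu_snd_le A B e : measurable B -> (m2 B < e%:E)%E -> measurable A ->
  mu (A `*` B) <= e.
Proof.
move=> mB; rewrite -mu_snd// lte_fin => /ltW Be mA; apply: le_trans Be.
by apply: mu_mono; [exact: measurableX|exact: measurableX|move=> [x y] []].
Qed.

Definition rect_content (A : set rT) : \bar R := (mu A)%:E.

Let rect_measurable (A : set rT) : measurable A -> measurable (A : set TT).
Proof. by move=> [A1 [A2 [mA1 mA2 ->]]]; exact: measurableX. Qed.

Let rect_content_ge0 A : (0 <= rect_content A)%E.
Proof. by rewrite lee_fin. Qed.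

Let rect_content_semi_additive : measure_function.semi_additive rect_content.
Proof.
move=> F n mF tF _; rewrite /rect_content mu_bigsetU//; last first.
  by move=> k; exact: rect_measurable.
by rewrite sumEFin.
Qed.

(* Compact sets from inside and open sets from outside reduce a countable
   cover by rectangles to a finite one. *)
Let rect_content_sigma_subadditive :
  measurable_subset_sigma_subadditive rect_content.
Proof.
move=> X Y mY mX XY; apply/lee_addgt0Pr => e e0.
have [A [B [mA mB XE]]] := mX.
have /choice[AB ABP] n : exists AB : set (borel T1) * set (borel T2),
    [/\ measurable AB.1, measurable AB.2 & Y n = AB.1 `*` AB.2].
  by have [A1 [A2 ?]] := mY n; exists (A1, A2).
(* Four losses: one for each side of the compact rectangle inside [X], and one for each family of
   sides of the open rectangles around the [Y n], the latter shared out by powers of two. *)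
have e4 : 0 < e / 4 by rewrite divr_gt0.
have [K [cK KA mK]] := measure_inner_compact m1 tT1 mA e4.
have [L [cL LB mL]] := measure_inner_compact m2 tT2 mB e4.
have en n : 0 < e / 4 / (2 ^ n.+1)%:R by rewrite !divr_gt0// ltr0n expn_gt0.
have /choice[U UP] n : exists U : set T1, [/\ open U, (AB n).1 `<=` U &
    (m1 (U `\` (AB n).1) < (e / 4 / (2 ^ n.+1)%:R)%:E)%E].
  by apply: measure_outer_regular => //; have [] := ABP n.
have /choice[V VP] n : exists V : set T2, [/\ open V, (AB n).2 `<=` V &
    (m2 (V `\` (AB n).2) < (e / 4 / (2 ^ n.+1)%:R)%:E)%E].
  by apply: measure_outer_regular => //; have [] := ABP n.
have [N _ NP] : \forall N \near \oo,
    K `*` L `<=` \big[setU/set0]_(i < N) (U i `*` V i).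
  have /compact_near_coveringP cKL := compact_setX cK cL.
  apply: (cKL _ _ (fun N x => (\big[setU/set0]_(i < N) (U i `*` V i)) x)).
  move=> [x y] [/= Kx Ly].
  have [n _ Yxy] : (\bigcup_n Y n) (x, y).
    by apply: XY; rewrite XE; split => /=; [exact: KA|exact: LB].
  have [oU AU _] := UP n; have [oV BV _] := VP n.
  have [_ _ YE] := ABP n; move: Yxy; rewrite YE => -[/= Ax By].
  exists (U n `*` V n, [set k | (n < k)%N]) => /=.
    split; last by exists n.+1.
    exists (U n, V n) => //=; split; apply: open_nbhs_nbhs; split => //.
      exact: AU.
    exact: BV.
  move=> [[x' y'] k] /= [[Ux' Vy'] nk].
  rewrite -(bigcup_mkord k (fun i => U i `*` V i)).
  by exists n.
have {}NP := NP N (leqnn N).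
have mU n : measurable (U n : set (borel T1)) by apply: borel_open; have [] := UP n.
have mV n : measurable (V n : set (borel T2)) by apply: borel_open; have [] := VP n.
have mKm : measurable (K : set (borel T1)).
  by apply: borel_closed; apply: compact_closed => //; exact: tame_hausdorff.
have mLm : measurable (L : set (borel T2)).
  by apply: borel_closed; apply: compact_closed => //; exact: tame_hausdorff.
have h1 : mu X <= mu (K `*` L) + (e / 4 + e / 4).
  have mX1 : measurable ((A `\` K) `*` setT : set TT).
    by apply: measurableX => //; exact: measurableD.
  have mX2 : measurable (setT `*` (B `\` L) : set TT).
    by apply: measurableX => //; exact: measurableD.
  have mX3 : measurable (K `*` L : set TT) by exact: measurableX.
  apply: (@le_trans _ _ (mu (K `*` L `|` ((A `\` K) `*` setT `|` setT `*` (B `\` L))))).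
    apply: mu_mono; first exact: rect_measurable.
      by apply: measurableU => //; exact: measurableU.
    rewrite XE => -[x y] [/= Ax By].
    have [Kx|nK] := pselect (K x); last by right; left.
    have [Ly|nL] := pselect (L y); last by right; right.
    by left.
  apply: (le_trans (mu_subadd _ _)) => //; first exact: measurableU.
  rewrite lerD2l; apply: (le_trans (mu_subadd _ _)) => //.
  apply: lerD; first by apply: mu_fst_le => //; exact: measurableD.
  by apply: mu_snd_le => //; exact: measurableD.
have h2 n : mu (U n `*` V n) <= mu (Y n) + e / 2 / (2 ^ n.+1)%:R.
  have [mA1 mA2 YE] := ABP n.
  have mX1 : measurable ((U n `\` (AB n).1) `*` setT : set TT).
    by apply: measurableX => //; exact: measurableD.
  have mX2 : measurable (setT `*` (V n `\` (AB n).2) : set TT).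
    by apply: measurableX => //; exact: measurableD.
  have mX3 : measurable (Y n : set TT) by exact: rect_measurable.
  apply: (@le_trans _ _ (mu (Y n `|`
      ((U n `\` (AB n).1) `*` setT `|` setT `*` (V n `\` (AB n).2))))).
    apply: mu_mono; first exact: measurableX.
      by apply: measurableU => //; exact: measurableU.
    move=> [x y] [/= Ux Vy].
    have [Ax|nA] := pselect ((AB n).1 x); last by right; left.
    have [By|nB] := pselect ((AB n).2 y); last by right; right.
    by left; rewrite YE.
  apply: (le_trans (mu_subadd _ _)) => //; first exact: measurableU.
  rewrite lerD2l; apply: (le_trans (mu_subadd _ _)) => //.
  apply: (@le_trans _ _ (e / 4 / (2 ^ n.+1)%:R + e / 4 / (2 ^ n.+1)%:R)); last first.
    rewrite -mulrDl ler_pM2r ?invr_gt0 ?ltr0n ?expn_gt0//; lra.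
  apply: lerD.
    by apply: mu_fst_le => //; [exact: measurableD|have [] := UP n].
  by apply: mu_snd_le => //; [exact: measurableD|have [] := VP n].
have h3 : mu (K `*` L) <= \sum_(i < N) (mu (Y i) + e / 2 / (2 ^ i.+1)%:R).
  apply: (@le_trans _ _ (mu (\big[setU/set0]_(i < N) (U i `*` V i)))).
    apply: mu_mono => //; first exact: measurableX.
    by apply: bigsetU_measurable => i _; exact: measurableX.
  apply: (@le_trans _ _ (\sum_(i < N) mu (U i `*` V i))).
    by apply: (mu_bigsetU_le (F := fun i => U i `*` V i)) => k; exact: measurableX.
  by apply: ler_sum => i _; exact: h2.
have h4 : ((mu (K `*` L))%:E <= \sum_(0 <= i <oo) rect_content (Y i) + (e / 2)%:E)%E.
  apply: (@le_trans _ _ (\sum_(0 <= i < N) (rect_content (Y i) +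
      (e / 2 / (2 ^ i.+1)%:R)%:E))%E).
    rewrite big_mkord/rect_content.
    under eq_bigr do rewrite -EFinD.
    by rewrite sumEFin lee_fin.
  apply: (@le_trans _ _ (\sum_(0 <= i <oo) (rect_content (Y i) +
      (e / 2 / (2 ^ i.+1)%:R)%:E))%E).
    apply: nneseries_lim_ge => n _ _; apply: adde_ge0 => //.
    by rewrite lee_fin !divr_ge0 ?ltW.
  by apply: epsilon_trick => //; rewrite divr_ge0 ?ltW.
apply: (@le_trans _ _ ((mu (K `*` L))%:E + (e / 2)%:E)%E).
  by rewrite -EFinD lee_fin; apply: (le_trans h1); lra.
have -> : (e%:E = (e / 2)%:E + (e / 2)%:E)%E by rewrite -EFinD; congr EFin; lra.
by rewrite addeA leeD2r.
Qed.

HB.instance Definition _ := isContent.Build _ _ _ rect_content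
  rect_content_ge0 rect_content_semi_additive.

HB.instance Definition _ := Content_SigmaSubAdditive_isMeasure.Build _ _ _
  rect_content rect_content_sigma_subadditive.

(** By second countability an open set of the product is a countable union of open rectangles. *)
Let borel_rect (A : set (T1 * T2)) : @measurable _ (borel (T1 * T2)%type) A ->
  <<s @rectangles _ _ (borel T1) (borel T2) >> A.
Proof.
apply: smallest_sub; first exact: smallest_sigma_algebra.
move=> W oW.
have [B1 [oB1 bB1]] := tame_base tT1; have [B2 [oB2 bB2]] := tame_base tT2.
pose D (k : nat) : set (T1 * T2) := if choice.unpickle k is Some (i, j) then
  (if `[< B1 i `*` B2 j `<=` W >] then B1 i `*` B2 j else set0) else set0.
have -> : W = \bigcup_k D k.
  apply/seteqP; split=> [[x y] Wxy|p [k _]]; last first.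
    rewrite /D; case: (choice.unpickle k) => // -[i j].
    by case: asboolP => // h /h.
  move: oW; rewrite openE => /(_ _ Wxy)[[U V] /= [nU nV] UVW].
  move: nU nV; rewrite !nbhsE => -[U' [oU' U'x] U'U] [V' [oV' V'y] V'V].
  have [i [Bi BU]] := bB1 _ _ oU' U'x; have [j [Bj BV]] := bB2 _ _ oV' V'y.
  exists (choice.pickle (i, j)) => //; rewrite /D choice.pickleK asboolT//.
  move=> [u v] [/= /BU/U'U Uu /BV/V'V Vv]; exact: UVW.
have [_ _ cU] : sigma_algebra setT <<s @rectangles _ _ (borel T1) (borel T2) >>.
  exact: smallest_sigma_algebra.
apply: cU => k; apply: sub_sigma_algebra.
have r0 : @rectangles _ _ (borel T1) (borel T2) set0.
  by exists set0, set0; split => //; rewrite setX0.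
rewrite /D; case: (choice.unpickle k) => // -[i j]; case: ifP => // _.
by exists (B1 i), (B2 j); split => //; exact: borel_open.
Qed.

(** Carathéodory's extension of the content on rectangles. Agreement is claimed there only:
    elsewhere [mu] is merely finitely additive and may differ from [P]. *)
Lemma rectangle_extension : exists P : probability (borel (T1 * T2)%type) R,
  forall A B, measurable (A : set (borel T1)) -> measurable (B : set (borel T2)) ->
    P (A `*` B) = (mu (A `*` B))%:E.
Proof.
pose nu := measure_extension rect_content.
have nuE A B : measurable (A : set (borel T1)) -> measurable (B : set (borel T2)) ->
    nu (A `*` B) = (mu (A `*` B))%:E.
  move=> mA mB; rewrite /nu/measure_extension measurable_mu_extE//.
  by exists A, B.
have [||||P PE] := @probability_of_measure _ (borel (T1 * T2)%type) R nu.
- exact: (measure0 nu).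
- by move=> A; exact: (measure_ge0 nu).
- move=> F mF tF mUF; apply: (measure_semi_sigma_additive (s := nu)) => //.
  + by move=> n; exact: borel_rect.
  + exact: borel_rect.
- by rewrite -setXTT nuE// mu_fst// probability_setT.
by exists P => A B mA mB; rewrite PE nuE.
Qed.

End RectangleExtension.

Lemma ultra_cvg_itv01 (R : realType) (I : Type) (F : set_system I) (u : I -> R) :
  UltraFilter F -> (forall n, 0 <= u n <= 1) ->
  exists l : R, u n @[n --> F] --> l.
Proof.
move=> FU u01; have PF : ProperFilter (u n @[n --> F]) by exact: fmap_proper_filter.
have [|l [_ cl]] := @segment_compact R 0 1 (u n @[n --> F]) PF.
  suff : F [set n | `[0, 1]%classic (u n)] by [].
  by apply: filterS filterT => n _ /=; rewrite in_itv/= u01.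
exists l => A nA; have [//|nFA] := in_ultra_setVsetC (u @^-1` A) FU.
by have [x []] := cl (~` A) A nFA nA.
Qed.

Lemma measure_bigcup_fintype d (T : measurableType d) (R : realType)
    (m : {measure set T -> \bar R}) (I : finType) (F : I -> set T) :
  (forall i, measurable (F i)) -> trivIset setT F ->
  m (\bigcup_i F i) = (\sum_i m (F i))%E.
Proof.
move=> mF tF; rewrite measure_fin_bigcup//; last exact: finite_finset.
rewrite (@fsbigE _ _ _ _ _ (index_enum I)) ?index_enum_uniq//.
  by apply: eq_bigl => i; rewrite in_setT.
by move=> i _; rewrite mem_index_enum.
Qed.

(** * Conditional products on finite partitions and their limit *)

Section Cells.
Context (T : Type) (A : nat -> set T) (n : nat).

(** The atom, possibly empty, of the algebra generated by the first [n] sets that has sign pattern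
    [c]. *)
Definition cell (c : {ffun 'I_n -> bool}) : set T :=
  \bigcap_(i : 'I_n) (if c i then A i else ~` A i).

Lemma cell_trivIset : trivIset setT cell.
Proof.
move=> c c' _ _ [x [cx cx']]; apply/ffunP => i.
by move: (cx i I) (cx' i I); case: (c i); case: (c' i).
Qed.

Lemma bigcup_cell : \bigcup_c cell c = setT.
Proof.
apply/seteqP; split => // x _; exists [ffun i : 'I_n => `[< A i x >]] => // i _.
by rewrite ffunE; case: asboolP.
Qed.

End Cells.

Lemma measurable_cell d (T : measurableType d) (A : nat -> set T) n c :
  (forall k, measurable (A k)) -> measurable (@cell T A n c).
Proof.
move=> mA; apply: fin_bigcap_measurable; first exact: finite_finset.
by move=> i _; case: ifP => _ //; exact: measurableC.
Qed.

Section Gluing.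
Context (R : realType) (d1 d2 : measure_display).
Context (T1 : measurableType d1) (T2 : measurableType d2).
Context (m1 : probability T1 R) (m2 : probability T2 R).
Context (A : nat -> set T1) (B : nat -> set T2).
Hypotheses (mA : forall k, measurable (A k)) (mB : forall k, measurable (B k)).
Hypothesis cellE : forall n (c : {ffun 'I_n -> bool}), m1 (cell A c) = m2 (cell B c).

Local Notation TT := (T1 * T2)%type.

(* The coupling of [m1] and [m2] which is the product measure conditionally on
   the [n]-th cell partition; cells of measure zero have weight [0^-1 = 0]. *)
Let p n (X : set TT) : R := \sum_(c : {ffun 'I_n -> bool})
  (fine (m2 (cell B c)))^-1 * fine ((m1 \x m2)%E (X `&` cell A c `*` cell B c)).

Let mcell1 n (c : {ffun 'I_n -> bool}) : measurable (cell A c).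
Proof. exact: measurable_cell. Qed.

Let mcell2 n (c : {ffun 'I_n -> bool}) : measurable (cell B c).
Proof. exact: measurable_cell. Qed.

Let mcells n (c : {ffun 'I_n -> bool}) : measurable (cell A c `*` cell B c).
Proof. exact: measurableX. Qed.

Let p_ge0 n X : 0 <= p n X.
Proof.
apply: sumr_ge0 => c _; rewrite mulr_ge0 ?invr_ge0 ?fine_ge0//.
Qed.

Let fin_prod (X : set TT) : measurable X -> (m1 \x m2)%E X \is a fin_num.
Proof.
move=> mX; rewrite ge0_fin_numE//.
apply: (@le_lt_trans _ _ ((m1 \x m2)%E (setT `*` setT))).
  by apply: le_measure; rewrite ?inE ?setXTT.
by rewrite product_measure1E// [X in (X * _)%E](probability_setT m1)
  [X in (_ * X)%E](probability_setT m2) mule1 ltey.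
Qed.

Let p_additive n X Y : measurable X -> measurable Y -> [disjoint X & Y] ->
  p n (X `|` Y) = p n X + p n Y.
Proof.
move=> mX mY; rewrite disj_set2E => /eqP XY.
rewrite -big_split/=; apply: eq_bigr => c _; rewrite -mulrDr -fineD; last 2 first.
  by apply: fin_prod; exact: measurableI.
  by apply: fin_prod; exact: measurableI.
rewrite setIUl measureU//; try exact: measurableI.
by rewrite setIACA XY set0I.
Qed.

(** Undoes the normalization. Null cells are covered as well: there [x], the mass of a part of the
    cell, vanishes too. *)
Let weight n (c : {ffun 'I_n -> bool}) (x : R) :
  (fine (m2 (cell B c)) = 0 -> x = 0) ->
  (fine (m2 (cell B c)))^-1 * (x * fine (m2 (cell B c))) = x.
Proof.
have [-> -> //|h _] := eqVneq (fine (m2 (cell B c))) 0; first by rewrite mul0r mulr0.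
by rewrite mulrCA mulVf// mulr1.
Qed.

Let fineK1 (X : set T1) : measurable X -> (fine (m1 X))%:E = m1 X.
Proof. by move=> mX; rewrite fineK//; exact: fin_num_measure. Qed.

Let fineK2 (X : set T2) : measurable X -> (fine (m2 X))%:E = m2 X.
Proof. by move=> mX; rewrite fineK//; exact: fin_num_measure. Qed.

Let fine_prod (X : set T1) (Y : set T2) : measurable X -> measurable Y ->
  fine ((m1 \x m2)%E (X `*` Y)) = fine (m1 X) * fine (m2 Y).
Proof.
move=> mX mY; rewrite product_measure1E// fineM//; exact: fin_num_measure.
Qed.

Let p_fst n X : measurable X -> (p n (X `*` setT))%:E = m1 X.
Proof.
move=> mX; rewrite /p -[in RHS](setIT X) -(bigcup_cell A n) setI_bigcupr.
rewrite measure_bigcup_fintype; last 2 first.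
  by move=> c; exact: measurableI.
  exact/trivIset_setIl/cell_trivIset.
rewrite -sumEFin; apply: eq_bigr => c _.
rewrite -setXI setTI fine_prod//; last exact: measurableI.
rewrite weight ?fineK1//; first exact: measurableI.
move=> h; apply/eqP; rewrite eq_le fine_ge0// andbT.
rewrite -lee_fin fineK1; last exact: measurableI.
rewrite -h fineK2// -cellE; apply: le_measure; rewrite ?inE//.
exact: measurableI.
Qed.

Let p_snd n Y : measurable Y -> (p n (setT `*` Y))%:E = m2 Y.
Proof.
move=> mY; rewrite /p -[in RHS](setIT Y) -(bigcup_cell B n) setI_bigcupr.
rewrite measure_bigcup_fintype; last 2 first.
  by move=> c; exact: measurableI.
  exact/trivIset_setIl/cell_trivIset.
rewrite -sumEFin; apply: eq_bigr => c _.
rewrite -setXI setTI fine_prod//; last exact: measurableI.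
rewrite cellE [X in _ * X]mulrC weight ?fineK2//; first exact: measurableI.
move=> h; apply/eqP; rewrite eq_le fine_ge0// andbT.
rewrite -lee_fin fineK2; last exact: measurableI.
rewrite -h fineK2//; apply: le_measure; rewrite ?inE//.
exact: measurableI.
Qed.

Let p_le1 n X : measurable X -> p n X <= 1.
Proof.
move=> mX; have -> : 1 = p n setT.
  by apply/eqP; rewrite -eqe -setXTT p_fst// probability_setT.
rewrite -(setUv X) p_additive ?lerDl//; first exact: measurableC.
by rewrite disj_set2E setICr.
Qed.

(** Paired cells carry the same sign at [k], so their product misses every rectangle with opposite
    signs. *)
Let p_diag n k X Y : (k < n)%N -> (X `<=` A k /\ Y `<=` ~` B k) \/
  (X `<=` ~` A k /\ Y `<=` B k) -> p n (X `*` Y) = 0.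
Proof.
move=> kn h; apply: big1 => c _; rewrite (_ : _ `&` _ = set0) ?measure0 ?mulr0//.
apply/seteqP; split=> // -[x y] [[/= Xx Yy] [/= cx cy]].
have := cx (Ordinal kn) I; have := cy (Ordinal kn) I => /=.
case: h => -[/(_ x Xx) + /(_ y Yy)] => /=; by case: (c _).
Qed.

(** The marginals of [p n] do not depend on [n], and mismatched rectangles are null from stage
    [k.+1] on, so both facts are exact in the limit. The ultrafilter makes all values converge at
    once. *)
Lemma conditional_product_limit : exists mu : set TT -> R,
  [/\ forall X, 0 <= mu X,
      (forall X Y, measurable X -> measurable Y -> [disjoint X & Y] ->
        mu (X `|` Y) = mu X + mu Y),
      (forall X, measurable X -> (mu (X `*` setT))%:E = m1 X),
      (forall Y, measurable Y -> (mu (setT `*` Y))%:E = m2 Y) &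
      forall k, mu (A k `*` ~` B k) = 0 /\ mu (~` A k `*` B k) = 0].
Proof.
have [F [FU ooF]] := @ultraFilterLemma nat \oo _.
(* The truncation bounds the values at arbitrary sets, so that [L] is total; at measurable sets it
   changes nothing by [p_le1]. *)
have /choice[L LP] (X : set TT) : exists l : R, Num.min 1 (p n X) @[n --> F] --> l.
  by apply: ultra_cvg_itv01 => n; rewrite le_min ler01 p_ge0 ge_min lexx.
have pL X : measurable X -> p n X @[n --> F] --> L X.
  move=> mX; rewrite (_ : (fun n => p n X) = fun n => Num.min 1 (p n X)).
    exact: LP.
  by apply/funext => n; rewrite min_r//; exact: p_le1.
have Leq X l : measurable X -> (\forall n \near F, p n X = l) -> L X = l.
  move=> mX h; apply: (@cvg_unique _ (@Rhausdorff R) _ _ _ _ (pL X mX)).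
  exact: cvg_near_cst.
exists L; split.
- move=> X; rewrite leNgt; apply/negP => L0.
  have /filter_ex[n] : \forall n \near F, Num.min 1 (p n X) < 0.
    exact: (cvgr_lt _ (LP X) _ L0).
  by rewrite ltNge le_min ler01 p_ge0.
- move=> X Y mX mY XY.
  apply: (@cvg_unique _ (@Rhausdorff R) _ _ _ _ (pL _ (measurableU _ _ mX mY))).
  rewrite (_ : (fun n => p n (X `|` Y)) = (fun n => p n X) \+ (fun n => p n Y)).
    exact: cvgD (pL X mX) (pL Y mY).
  by apply/funext => n /=; rewrite p_additive.
- move=> X mX; rewrite (Leq _ (fine (m1 X))) ?fineK1//; first exact: measurableX.
  apply: filterS filterT => n _; apply/eqP; rewrite -eqe p_fst// fineK1//.
- move=> Y mY; rewrite (Leq _ (fine (m2 Y))) ?fineK2//; first exact: measurableX.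
  apply: filterS filterT => n _; apply/eqP; rewrite -eqe p_snd// fineK2//.
- move=> k; have Fk : F [set n | (k < n)%N] by apply: ooF; exists k.+1.
  split; apply: Leq.
  + by apply: measurableX => //; exact: measurableC.
  + by apply: filterS Fk => n kn; apply: (p_diag kn); left; split; exact: subset_refl.
  + by apply: measurableX => //; exact: measurableC.
  + by apply: filterS Fk => n kn; apply: (p_diag kn); right; split; exact: subset_refl.
Qed.

End Gluing.

(* [A] and [B] encode two maps into the Cantor space under which [m1] and [m2]
   have the same image; the coupling is supported on their fibre product. *)
Lemma gluing (R : realType) (T1 T2 : ptopologicalType)
    (m1 : probability (borel T1) R) (m2 : probability (borel T2) R)
    (A : nat -> set (borel T1)) (B : nat -> set (borel T2)) :
  tame_space T1 -> tame_space T2 ->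
  (forall k, measurable (A k)) -> (forall k, measurable (B k)) ->
  (forall n (c : {ffun 'I_n -> bool}), m1 (cell A c) = m2 (cell B c)) ->
  exists P : probability (borel (T1 * T2)%type) R,
    [/\ forall X : set (borel T1), measurable X -> P (X `*` setT) = m1 X,
        forall Y : set (borel T2), measurable Y -> P (setT `*` Y) = m2 Y &
        forall k, P (A k `*` ~` B k) = 0%E /\ P (~` A k `*` B k) = 0%E].
Proof.
move=> tT1 tT2 mA mB cellE.
have [mu [mu0 muD mu1 mu2 muk]] := conditional_product_limit mA mB cellE.
have [P PE] := rectangle_extension tT1 tT2 mu0 muD mu1 mu2.
exists P; split.
- by move=> X mX; rewrite PE// mu1.
- by move=> Y mY; rewrite PE// mu2.
- move=> k; have [h1 h2] := muk k; rewrite !PE ?h1 ?h2//; exact: measurableC.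
Qed.

(** * The distance quotient *)

Lemma measure_setI_full d (T : measurableType d) (R : realType)
    (m : {measure set T -> \bar R}) (S A : set T) :
  measurable S -> m (~` S) = 0%E -> measurable A -> m (S `&` A) = m A.
Proof.
move=> mS mS0 mA; rewrite -[in RHS](setUIDK A S) measureU.
- rewrite [X in (_ + X)%E](_ : _ = 0%E) ?adde0 1?setIC//.
  apply/eqP; rewrite eq_le measure_ge0 andbT -mS0.
  apply: le_measure; rewrite ?inE; [exact: measurableD|exact: measurableC|].
  by move=> y [].
- exact: measurableI.
- exact: measurableD.
- by rewrite setDE setIACA setICr setI0.
Qed.

Lemma closedX (T U : topologicalType) (A : set T) (B : set U) :
  closed A -> closed B -> closed (A `*` B).
Proof.
move=> cA cB; rewrite (_ : A `*` B = fst @^-1` A `&` snd @^-1` B); last first.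
  by apply/seteqP; split.
by apply: closedI; apply: closed_comp => // x _; [exact: cvg_fst|exact: cvg_snd].
Qed.

Section QuotientMap.
Context (R : realType) (M : nblmms R).

Let tauP : is_blms (tsep M) := tsepP M.

(* The projection onto the distance quotient, with a junk value off the
   support. *)
Definition qmap (x : tspace M) : qi0 M :=
  if pselect (x \in spt M) is left h
  then to_with_i0 (qtsep M) (qproj (exist _ x h)) else point.

Lemma spt_closed : closed (spt M).
Proof. exact: support_closed. Qed.

Lemma measurable_spt : measurable (spt M : set (borel (tspace M))).
Proof. by apply: (@borel_closed (tspace M)); exact: spt_closed. Qed.

Lemma meas_setC_spt : meas M (~` spt M) = 0%E.
Proof. by apply: measure_setC_support; exact: tame_base (blms_tame tauP). Qed.

Lemma qmapE (x : spt M) : qmap (val x) = to_with_i0 (qtsep M) (qproj x).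
Proof.
rewrite /qmap; case: pselect => [h|]; last by move=> []; exact: valP.
by congr (to_with_i0 _ (qproj _)); apply: val_inj.
Qed.

Lemma qmap_tsep (x y : tspace M) : spt M x -> spt M y ->
  qi0_tsep M (qmap x) (qmap y) = tsep M x y.
Proof.
move=> /mem_set hx /mem_set hy.
by rewrite (qmapE (exist _ x hx)) (qmapE (exist _ y hy)) /qi0_tsep/tau_i0/= qtsepE.
Qed.

Lemma qmap_cover (a : qi0 M) :
  (exists2 x, spt M x & qmap x = a) \/ is_spacelike_boundary (qi0_tsep M) a.
Proof.
case: a => -[b|] h; last by right => c; rewrite /qi0_tsep/tau_i0/=; case: (val c).
left; pose x : spt M := repr (b : {eq_quot (indist_equiv M)}).
exists (val x); first exact/set_mem/(valP x).
rewrite qmapE; apply: val_inj => /=; congr Some.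
exact: reprK.
Qed.

Lemma qi0_boundary : exists i : qi0 M, is_spacelike_boundary (qi0_tsep M) i.
Proof.
have [[i bi]|h] := pselect (exists i, is_spacelike_boundary (qtsep M) i).
  exists (to_with_i0 (qtsep M) i) => -[[b|] hb]; rewrite /qi0_tsep/tau_i0/=.
    exact: bi.
  by [].
have hN : None \in [set o : option (dquot M) | o = None ->
    ~ (exists i, is_spacelike_boundary (qtsep M) i)] by rewrite inE.
by exists (exist _ None hN) => c; rewrite /qi0_tsep/tau_i0/=; case: (val c).
Qed.

(** Distinct classes are separated by the very relation defining the quotient. A class not separated
    from the adjoined point would be a boundary already, in which case nothing is adjoined. *)
Lemma qi0_separation (a b : qi0 M) : a <> b ->
  exists z, qi0_tsep M a z <> qi0_tsep M b z \/ qi0_tsep M z a <> qi0_tsep M z b.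
Proof.
have someP c : exists x : spt M, c = qproj x.
  exists (repr (c : {eq_quot (indist_equiv M)})).
  by rewrite /qproj reprK.
pose t := to_with_i0 (qtsep M).
have some_none (c : dquot M) : (forall z, qi0_tsep M (t c) (t z) = 0 /\
    qi0_tsep M (t z) (t c) = 0) -> is_spacelike_boundary (qtsep M) c.
  by move=> h z; exact: h.
case: a b => -[a|] ha [[b|] hb] ab.
- have [x ax] := someP a; have [y by_] := someP b.
  apply: contrapT => /forallNP h; apply: ab; apply: val_inj => /=; congr Some.
  rewrite ax by_; apply/(eqquotP {eq_quot (indist_equiv M)}).
  apply/asboolP => z; have /not_orP[/contrapT h1 /contrapT h2] := h (t (qproj z)).
  by move: h1 h2; rewrite /qi0_tsep/tau_i0/= ax by_ !qtsepE.
- apply: contrapT => /forallNP h.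
  have := set_mem hb erefl; apply; exists a; apply: some_none => z.
  by have /not_orP[/contrapT h1 /contrapT h2] := h (t z); split;
    [rewrite -[RHS]h1|rewrite -[RHS]h2].
- apply: contrapT => /forallNP h.
  have := set_mem ha erefl; apply; exists b; apply: some_none => z.
  by have /not_orP[/contrapT h1 /contrapT h2] := h (t z); split;
    [exact: (esym h1)|exact: (esym h2)].
- by exfalso; apply: ab; exact: val_inj.
Qed.

(** The topology is built from the separations through [qmap] on the support rather than as a
    quotient topology. Superlevel sets stay compact on the support because it is closed. *)
Lemma qi0_blms : is_blms (qi0_tsep M).
Proof.
have ge0 a b : 0 <= qi0_tsep M a b.
  rewrite /qi0_tsep/tau_i0; case: (val a) => // a'; case: (val b) => // b'.
  exact: blms_ge0 tauP _ _.
split => //.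
- move=> a b c ab bc.
  have nb z z' : 0 < qi0_tsep M z z' ->
      ~ is_spacelike_boundary (qi0_tsep M) z /\ ~ is_spacelike_boundary (qi0_tsep M) z'.
    by move=> h; split=> bd; move: h; rewrite ?(bd _).1 ?(bd _).2 ltxx.
  have [na nb'] := nb _ _ ab; have [_ nc] := nb _ _ bc.
  have [[x Sx xa]|//] := qmap_cover a; have [[y Sy yb]|//] := qmap_cover b.
  have [[z Sz zc]|//] := qmap_cover c.
  move: ab bc; rewrite -xa -yb -zc !qmap_tsep//.
  exact: blms_reverse_triangle tauP _ _ _.
- have [||||||d [_ dT]] := @tau_topology_exists R (tspace M) (qi0 M)
    (tsep M) (spt M) (qi0_tsep M) qmap.
  + exact: blms_continuous tauP.
  + move=> e e0.
    rewrite (_ : [set p : tspace M * tspace M | _] =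
      [set p : tspace M * tspace M | e <= tsep M p.1 p.2] `&` (spt M `*` spt M)).
      apply: compact_closedI; first exact: blms_compact tauP _ e0.
      by apply: closedX; exact: spt_closed.
    by apply/seteqP; split=> [p [? ? ?]|p [? [? ?]]].
  + exact: qmap_tsep.
  + exact: ge0.
  + exact: qmap_cover.
  + exact: qi0_separation.
  by exists (init_topology (tau_sections (qi0_tsep M) d)).
- exact: qi0_separation.
Qed.

Lemma qmap_cvg (x : tspace M) : spt M x ->
  qmap y @[y --> within (spt M) (nbhs x)] --> (qmap x : qi0_space M).
Proof.
move=> Sx.
have near_spt : \forall y \near within (spt M) (nbhs x), spt M y by exact: withinT.
apply: (cvg_lspace qi0_blms) => z; have [[c Sc <-]|bd] := qmap_cover z.
- rewrite qmap_tsep//.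
  have : tsep M c y @[y --> within (spt M) (nbhs x)] --> tsep M c x.
    by apply: cvg_within_filter; exact: blms_continuousl tauP _ _.
  apply: cvg_trans; apply: near_eq_cvg; apply: filterS near_spt => y Sy.
  by rewrite qmap_tsep.
- rewrite (bd _).1 (_ : (fun t => _) = cst 0); first exact: cvg_cst.
  by apply/funext => y /=; rewrite (bd _).1.
- rewrite qmap_tsep//.
  have : tsep M y c @[y --> within (spt M) (nbhs x)] --> tsep M x c.
    by apply: cvg_within_filter; exact: blms_continuousr tauP _ _.
  apply: cvg_trans; apply: near_eq_cvg; apply: filterS near_spt => y Sy.
  by rewrite qmap_tsep.
- rewrite (bd _).2 (_ : (fun t => _) = cst 0); first exact: cvg_cst.
  by apply/funext => y /=; rewrite (bd _).2.
Qed.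

Lemma qmap_open (U : set (qi0_space M)) : open U ->
  exists2 V : set (tspace M), open V & spt M `&` qmap @^-1` U = spt M `&` V.
Proof.
move=> oU; exists [set y | spt M y -> U (qmap y)]°; first exact: open_interior.
apply/seteqP; split=> y [Sy h]; split => //.
  exact: (qmap_cvg Sy (open_nbhs_nbhs (conj oU h))).
exact: (interior_subset h).
Qed.

Lemma measurable_qmap :
  measurable_fun setT (qmap : borel (tspace M) -> borel (qi0_space M)).
Proof.
apply: (@measurability _ _ (borel (tspace M)) (borel (qi0_space M)) setT qmap
  (@open (qi0_space M))) => //.
move=> _ [U oU <-]; rewrite setTI.
have [V oV SV] := qmap_open oU.
rewrite -(setIT (qmap @^-1` U)) -(setUv (spt M)) setIUr setIC SV.
apply: measurableU.
  by apply: measurableI; [exact: measurable_spt|exact: borel_open].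
(* Off the support [qmap] is constantly [point], so the preimage contains all of that part or none
   of it. *)
have [Up|nUp] := pselect (U point).
  rewrite (_ : _ `&` _ = ~` spt M); first exact: (measurableC measurable_spt).
  apply/seteqP; split=> [y []//|y nS]; split => //=; rewrite /qmap.
  by case: pselect => // h; exfalso; apply: nS; exact: set_mem.
rewrite (_ : _ `&` _ = set0); first exact: measurable0.
apply/seteqP; split=> // y [/= + nS]; rewrite /qmap.
by case: pselect => // h; exfalso; apply: nS; exact: set_mem.
Qed.

Lemma meas_setI_spt (A : set (borel (tspace M))) : measurable A ->
  meas M (spt M `&` A) = meas M A.
Proof. by apply: measure_setI_full; [exact: measurable_spt|exact: meas_setC_spt]. Qed.

Lemma qi0_measE (A : set (borel (qi0_space M))) : measurable A ->
  qi0_meas M A = meas M (qmap @^-1` A).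
Proof.
move=> mA; rewrite -meas_setI_spt; last first.
  by rewrite -[X in measurable X]setTI; exact: measurable_qmap.
rewrite /qi0_meas; congr (meas M _); apply/seteqP; split=> [_ [x Ax <-]|x [Sx Ax]].
  by split; [exact/set_mem/(valP x)|rewrite /= qmapE].
by exists (exist _ x (mem_set Sx)) => //=; rewrite -qmapE.
Qed.

Lemma qi0_probability : exists P : probability (borel (qi0_space M)) R,
  forall A, P A = meas M (qmap @^-1` A).
Proof.
pose mu (A : set (borel (qi0_space M))) := meas M (qmap @^-1` A).
have mq A : measurable (A : set (borel (qi0_space M))) ->
    measurable (qmap @^-1` A : set (borel (tspace M))).
  by move=> mA; rewrite -[X in measurable X]setTI; exact: measurable_qmap.
apply: (probability_of_measure (mu := mu)).
- by rewrite /mu preimage_set0 measure0.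
- by move=> A; exact: measure_ge0.
- move=> F mF tF mUF; rewrite /mu preimage_bigcup.
  apply: measure_semi_sigma_additive.
  + by move=> n; apply: mq; exact: mF.
  + by move=> i j _ _ [x [Fi Fj]]; apply: tF => //; exists (qmap x).
  + by rewrite -preimage_bigcup; exact: mq.
- by rewrite /mu preimage_setT probability_setT.
Qed.

(** A non-boundary point comes from a point of the support, near which the preimage of [U] is
    relatively open. The boundary is excluded because it may be the adjoined null point. *)
Lemma qi0_meas_gt0 (U : set (qi0_space M)) (a : qi0 M) : open U -> U a ->
  ~ is_spacelike_boundary (qi0_tsep M) a -> (0 < meas M (qmap @^-1` U))%E.
Proof.
move=> oU Ua nb; have [[x Sx xa]|//] := qmap_cover a.
have [V oV SV] := qmap_open oU.
have Vx : V x by have : (spt M `&` V) x; [rewrite -SV; split => //=; rewrite xa|case].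
rewrite -meas_setI_spt; last first.
  by rewrite -[X in measurable X]setTI; apply: measurable_qmap => //; exact: borel_open.
by rewrite SV meas_setI_spt; [exact: Sx|exact: borel_open].
Qed.

End QuotientMap.
Arguments qmap {R M} x.

(** * Distance-preserving maps with dense image *)

Section Hit.
Context (R : realType) (Y : pointedType) (tau : Y -> Y -> R) (tauP : is_blms tau).
Context (P : topologicalType) (S : set P) (h : P -> Y) (s : P -> P -> R).
Hypothesis S_closed : closed S.
Hypothesis s_contl : forall r, continuous (s^~ r).
Hypothesis s_contr : forall r, continuous (s r).
Hypothesis hE : forall p r, S p -> S r -> tau (h p) (h r) = s p r.
Hypothesis s_compact : forall r (e : R), S r -> 0 < e ->
  exists2 C : set P, compact C &
    forall p, S p -> e <= s p r \/ e <= s r p -> C p.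
Hypothesis h_dense : forall y (U : set (lspace tau)),
  ~ is_spacelike_boundary tau y -> open U -> U y -> exists2 p, S p & U (h p).

Let nbhs_dense y (U : set (lspace tau)) : ~ is_spacelike_boundary tau y ->
  nbhs (y : lspace tau) U -> exists2 p, S p & U (h p).
Proof.
move=> nb; rewrite nbhsE => -[V [oV Vy] VU].
by have [p Sp Vp] := h_dense nb oV Vy; exists p => //; exact: VU.
Qed.

Let dense_eq (f g : lspace tau -> R) y : ~ is_spacelike_boundary tau y ->
  continuous f -> continuous g -> (forall p, S p -> f (h p) = g (h p)) ->
  f y = g y.
Proof.
move=> nb cf cg fg; apply: (@Rhausdorff R) => A B nA nB.
have n1 : nbhs (y : lspace tau) (f @^-1` A) by exact: cf.
have n2 : nbhs (y : lspace tau) (g @^-1` B) by exact: cg.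
have [p Sp [Ap Bp]] := nbhs_dense nb (filterI n1 n2).
by exists (f (h p)); split => //; rewrite fg.
Qed.

(* The points of [S] with image close to [y] stay in a compact set, as one of
   their time separations is bounded away from zero; by separation, any of
   their cluster points is mapped to [y]. *)
Lemma dense_isometry_hits y : ~ is_spacelike_boundary tau y ->
  exists2 p, S p & h p = y.
Proof.
move=> nby.
pose F := filter_from (nbhs (y : lspace tau)) (fun U => S `&` h @^-1` U).
have FF : ProperFilter F.
  apply: filter_from_proper; last first.
    by move=> U /(nbhs_dense nby)[p Sp Up]; exists p.
  apply: filter_from_filter; first by exists setT; exact: filterT.
  move=> U V nU nV; exists (U `&` V); first exact: filterI.
  by move=> p [Sp [Up Vp]].
(* Along [F] the common values on [S] converge to [f y] and cluster at [g p]. *)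
have cl_eq (f : lspace tau -> R) (g : P -> R) p : continuous f -> continuous g ->
    (forall q, S q -> f (h q) = g q) -> cluster F p -> f y = g p.
  move=> cf cg fg cl; apply: (@Rhausdorff R) => A B nA nB.
  have FA : F (S `&` h @^-1` (f @^-1` A)) by exists (f @^-1` A) => //; exact: cf.
  have [q [[Sq Aq] Bq]] := cl _ _ FA (cg p B nB).
  by exists (f (h q)); split => //; rewrite fg.
have [C cC FC] : exists2 C : set P, compact C & F C.
  have [z zP] := blms_nonboundary tauP nby.
  have nbz : ~ is_spacelike_boundary tau z.
    by move=> b; move: zP; rewrite (b y).1 (b y).2 ltxx; case.
  case: zP => t0.
  - pose e := tau y z / 2.
    have e0 : 0 < e by rewrite divr_gt0.
    have ey : e < tau y z by rewrite /e; lra.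
    (* [z] has to be moved into the image of [S], since [s_compact] speaks of reference points in
       [S] only; halving the separation leaves room for the move. *)
    have nz : nbhs (z : lspace tau) [set z' | e < tau y z'].
      exact: (cvgr_gt _ (@blms_continuousl _ _ _ tauP y z) _ ey).
    have [r Sr er] := nbhs_dense nbz nz.
    have [C cC CP] := s_compact Sr e0; exists C => //.
    exists [set u | e < tau u (h r)].
      exact: (cvgr_gt _ (@blms_continuousr _ _ _ tauP (h r) y) _ er).
    by move=> p [Sp /= ep]; apply: CP => //; left; rewrite -hE// ltW.
  - pose e := tau z y / 2.
    have e0 : 0 < e by rewrite divr_gt0.
    have ey : e < tau z y by rewrite /e; lra.
    have nz : nbhs (z : lspace tau) [set z' | e < tau z' y].
      exact: (cvgr_gt _ (@blms_continuousr _ _ _ tauP y z) _ ey).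
    have [r Sr er] := nbhs_dense nbz nz.
    have [C cC CP] := s_compact Sr e0; exists C => //.
    exists [set u | e < tau (h r) u].
      exact: (cvgr_gt _ (@blms_continuousl _ _ _ tauP (h r) y) _ er).
    by move=> p [Sp /= ep]; apply: CP => //; right; rewrite -hE// ltW.
have [p [_ cl]] := cC F FF FC.
have Sp : S p.
  apply: S_closed => B nB; have FS : F S.
    by exists setT; [exact: filterT|move=> q []].
  by have [q [Sq Bq]] := cl S B FS nB; exists q.
exists p => //; apply: contrapT => /(blms_separation tauP)[z zP].
have nbz : ~ is_spacelike_boundary tau z.
  by move=> b; move: zP; rewrite !(b _).1 !(b _).2; case.
(* By density it is enough to compare [h p] and [y] against the points [h r], and there [cl_eq]
   applies. *)
case: zP; apply.
- apply: (dense_eq (f := tau (h p)) (g := tau y)) => //.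
  + exact: blms_continuousl.
  + exact: blms_continuousl.
  + move=> r Sr; rewrite hE//; symmetry.
    apply: (cl_eq (fun u => tau u (h r)) (s^~ r)) => //.
      exact: blms_continuousr.
    by move=> q Sq; exact: hE.
- apply: (dense_eq (f := fun z => tau z (h p)) (g := fun z => tau z y)) => //.
  + exact: blms_continuousr.
  + exact: blms_continuousr.
  + move=> r Sr; rewrite hE//; symmetry.
    apply: (cl_eq (tau (h r)) (s r)) => //.
      exact: blms_continuousl.
    by move=> q Sq; exact: hE.
Qed.

End Hit.

(** A point of [Y'] is determined by its separations with the points [h' r], since a separating
    point is never the boundary and hence is hit. So [iota a] can be defined by prescribing these
    separations to be those of [a]; the boundary, which [h] may miss, goes to [i]. Continuity holds
    because the sections of [tau'] pull back to sections of [tau] or to zero. *)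
Lemma isometry_transfer (R : realType) (Y Y' : pointedType)
    (tau : Y -> Y -> R) (tau' : Y' -> Y' -> R) (tauP : is_blms tau)
    (tauP' : is_blms tau') (P : Type) (S : set P) (h : P -> Y) (h' : P -> Y') :
  (forall y, ~ is_spacelike_boundary tau y -> exists2 p, S p & h p = y) ->
  (forall y, ~ is_spacelike_boundary tau' y -> exists2 p, S p & h' p = y) ->
  (exists i, is_spacelike_boundary tau' i) ->
  (forall p r, S p -> S r -> tau (h p) (h r) = tau' (h' p) (h' r)) ->
  exists iota : lspace tau -> lspace tau', [/\ distance_preserving tau tau' iota,
    continuous iota & forall p, S p -> iota (h p) = h' p].
Proof.
move=> hit hit' [i bi] hh'.
have uniq' (a b : Y') : (forall r, S r -> tau' a (h' r) = tau' b (h' r) /\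
    tau' (h' r) a = tau' (h' r) b) -> a = b.
  move=> ab; apply: contrapT => /(blms_separation tauP')[z zP].
  have nbz : ~ is_spacelike_boundary tau' z.
    by move=> b'; move: zP; rewrite !(b' _).1 !(b' _).2; case.
  have [r Sr rz] := hit' z nbz; have [h1 h2] := ab r Sr.
  by move: zP; rewrite -rz h1 h2; case.
have /choice[iota iotaP] (a : lspace tau) : exists b : lspace tau', forall r, S r ->
    tau' b (h' r) = tau a (h r) /\ tau' (h' r) b = tau (h r) a.
  have [b|nb] := pselect (is_spacelike_boundary tau a).
    by exists i => r _; rewrite (bi _).1 (bi _).2 (b _).1 (b _).2.
  by have [p Sp <-] := hit a nb; exists (h' p) => r Sr; rewrite !hh'.
have iotaE p : S p -> iota (h p) = h' p.
  by move=> Sp; apply: uniq' => r Sr; have [-> ->] := iotaP (h p) r Sr; rewrite !hh'.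
have iota_bd b : is_spacelike_boundary tau b -> iota b = i.
  move=> bb; apply: uniq' => r Sr; have [-> ->] := iotaP b r Sr.
  by rewrite (bi _).1 (bi _).2 (bb _).1 (bb _).2.
exists iota; split => //.
- move=> a b; have [bb|nb] := pselect (is_spacelike_boundary tau b).
    by rewrite (iota_bd b bb) (bb a).2 (bi _).2.
  by have [r Sr <-] := hit b nb; rewrite iotaE//; have [-> _] := iotaP a r Sr.
- move=> a; apply: (cvg_lspace tauP' (nbhs_filter (a : lspace tau))) => z.
    have [bz|nb] := pselect (is_spacelike_boundary tau' z).
      rewrite (bz _).1 (_ : (fun t => _) = cst 0); first exact: cvg_cst.
      by apply/funext => t /=; rewrite (bz _).1.
    have [r Sr <-] := hit' z nb; have [_ ->] := iotaP a r Sr.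
    rewrite (_ : (fun t => _) = tau (h r)); first exact: blms_continuousl tauP _ _.
    by apply/funext => t; have [_ ->] := iotaP t r Sr.
  have [bz|nb] := pselect (is_spacelike_boundary tau' z).
    rewrite (bz _).2 (_ : (fun t => _) = cst 0); first exact: cvg_cst.
    by apply/funext => t /=; rewrite (bz _).2.
  have [r Sr <-] := hit' z nb; have [-> _] := iotaP a r Sr.
  rewrite (_ : (fun t => _) = tau^~ (h r)); first exact: blms_continuousr tauP _ _.
  by apply/funext => t; have [-> _] := iotaP t r Sr.
Qed.

(** * Isomorphy *)

HB.instance Definition _ (T1 T2 : ptopologicalType) :=
  Pointed.on (T1 * T2)%type.

Lemma openX (T U : topologicalType) (A : set T) (B : set U) :
  open A -> open B -> open (A `*` B).
Proof.
move=> oA oB; rewrite (_ : A `*` B = fst @^-1` A `&` snd @^-1` B); last first.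
  by apply/seteqP; split.
by apply: openI; apply: open_comp => // x _; [exact: cvg_fst|exact: cvg_snd].
Qed.

Lemma continuous_measurable_borel (T U : ptopologicalType) (f : T -> U) :
  continuous f -> measurable_fun setT (f : borel T -> borel U).
Proof.
move=> cf; apply: (@measurability _ _ (borel T) (borel U) setT f (@open U)) => //.
move=> _ [V oV <-]; rewrite setTI; apply: borel_open.
by apply: open_comp => // x _; exact: cf.
Qed.

Section ProductBorel.
Context (T1 T2 : ptopologicalType).

Lemma measurable_fst_borel :
  measurable_fun setT (fst : borel (T1 * T2)%type -> borel T1).
Proof.
by apply: (@continuous_measurable_borel (T1 * T2)%type T1 fst) => p; exact: cvg_fst.
Qed.

Lemma measurable_snd_borel :
  measurable_fun setT (snd : borel (T1 * T2)%type -> borel T2).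
Proof.
by apply: (@continuous_measurable_borel (T1 * T2)%type T2 snd) => p; exact: cvg_snd.
Qed.

Lemma measurable_fst_preimage (A : set (borel T1)) : measurable A ->
  measurable (fst @^-1` A : set (borel (T1 * T2)%type)).
Proof.
by move=> mA; rewrite -[X in measurable X]setTI; exact: measurable_fst_borel.
Qed.

Lemma measurable_snd_preimage (A : set (borel T2)) : measurable A ->
  measurable (snd @^-1` A : set (borel (T1 * T2)%type)).
Proof.
by move=> mA; rewrite -[X in measurable X]setTI; exact: measurable_snd_borel.
Qed.

Lemma borel_setX (A : set (borel T1)) (B : set (borel T2)) :
  measurable A -> measurable B -> measurable (A `*` B : set (borel (T1 * T2)%type)).
Proof.
move=> mA mB; rewrite (_ : A `*` B = fst @^-1` A `&` snd @^-1` B); last first.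
  by apply/seteqP; split.
by apply: measurableI; [exact: measurable_fst_preimage|exact: measurable_snd_preimage].
Qed.

Lemma tame_base_prod : tame_space T1 -> tame_space T2 ->
  exists B : nat -> set (T1 * T2), (forall n, open (B n)) /\
    forall (U : set (T1 * T2)) x, open U -> U x -> exists n, B n x /\ B n `<=` U.
Proof.
move=> tT1 tT2; have [B1 [oB1 bB1]] := tame_base tT1.
have [B2 [oB2 bB2]] := tame_base tT2.
exists (fun k => if choice.unpickle k is Some (i, j) then B1 i `*` B2 j else set0).
split=> [k|W [x y] oW Wxy].
  by case: (choice.unpickle k) => [[i j]|]; [exact: openX|exact: open0].
move: oW; rewrite openE => /(_ _ Wxy)[[U V] /= [nU nV] UVW].
move: nU nV; rewrite !nbhsE => -[U' [oU' U'x] U'U] [V' [oV' V'y] V'V].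
have [i [Bi BU]] := bB1 _ _ oU' U'x; have [j [Bj BV]] := bB2 _ _ oV' V'y.
exists (choice.pickle (i, j)); rewrite choice.pickleK; split => //.
by move=> [u v] [/= /BU/U'U Uu /BV/V'V Vv]; exact: UVW.
Qed.

End ProductBorel.

Lemma cell_preimage (T U : Type) (f : T -> U) (B : nat -> set U) n
    (c : {ffun 'I_n -> bool}) :
  cell (fun k => f @^-1` B k) c = f @^-1` cell B c.
Proof.
by apply/seteqP; split=> x hx i _; have := hx i I => /=; case: (c i).
Qed.

Section Isomorphy.
Context (R : realType) (M M' : nblmms R).

Let tauP := tsepP M.
Let tauP' := tsepP M'.
Local Notation T := (tspace M).
Local Notation T' := (tspace M').

Lemma isomorphic_coupling : isomorphic M M' ->
  exists2 pi : probability (borel (tspace M * tspace M')%type) R, is_coupling pi &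
    \forall p \ae (pi \x pi)%E, tsep M p.1.1 p.2.1 = tsep M' p.1.2 p.2.2.
Proof.
move=> [iota [iotaE miota iota_push]].
have tQ : tame_space (qi0_space M') := blms_tame (qi0_blms M').
(* A countable base of a Hausdorff space separates points, so membership in the [B k] encodes a
   point of the quotient. *)
have [B [oB bB]] := tame_base tQ.
have mB k : measurable (B k : set (borel (qi0_space M'))) by exact: borel_open.
pose phi (x : borel T) : borel (qi0_space M') := iota (qmap x).
pose psi (x : borel T') : borel (qi0_space M') := qmap x.
have mphi X : measurable (X : set (borel (qi0_space M'))) ->
    measurable (phi @^-1` X : set (borel T)).
  move=> mX; have mX1 : measurable (iota @^-1` X).
    by rewrite -[Z in measurable Z]setTI; exact: miota.
  rewrite (_ : phi @^-1` X = qmap @^-1` (iota @^-1` X))//.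
  by rewrite -[Z in measurable Z]setTI; exact: (measurable_qmap (M := M)).
have mpsi X : measurable (X : set (borel (qi0_space M'))) ->
    measurable (psi @^-1` X : set (borel T')).
  by move=> mX; rewrite -[Z in measurable Z]setTI; exact: (measurable_qmap (M := M')).
have push X : measurable (X : set (borel (qi0_space M'))) ->
    meas M (phi @^-1` X) = meas M' (psi @^-1` X).
  move=> mX; have := iota_push X mX; rewrite /pushforward !qi0_measE//.
  by rewrite -[Z in measurable Z]setTI; exact: miota.
have [|||||pi [pi1 pi2 pik]] := @gluing R T T' (meas M) (meas M')
  (fun k => phi @^-1` B k) (fun k => psi @^-1` B k).
- exact: blms_tame tauP.
- exact: blms_tame tauP'.
- by move=> k; exact: mphi.
- by move=> k; exact: mpsi.
- move=> n c; rewrite (cell_preimage phi B c) (cell_preimage psi B c).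
  exact: (push (cell B c) (measurable_cell c mB)).
exists pi.
  split=> A mA; rewrite /pushforward.
    by rewrite -pi1//; congr (pi _); apply/seteqP; split=> [x ?|x []].
  by rewrite -pi2//; congr (pi _); apply/seteqP; split=> [x ?|x []].
pose good (p : T * T') := [/\ spt M p.1, spt M' p.2 & phi p.1 = psi p.2].
have neg : pi.-negligible [set p | ~ good p].
  have mS : measurable (spt M : set (borel T)) by exact: measurable_spt.
  have mS' : measurable (spt M' : set (borel T')) by exact: measurable_spt.
  have n1 : pi.-negligible (~` spt M `*` setT).
    apply/negligibleP; first by apply: borel_setX => //; exact: measurableC.
    by rewrite -[RHS](meas_setC_spt M); exact: (pi1 _ (measurableC mS)).
  have n2 : pi.-negligible (setT `*` ~` spt M').
    apply/negligibleP; first by apply: borel_setX => //; exact: measurableC.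
    by rewrite -[RHS](meas_setC_spt M'); exact: (pi2 _ (measurableC mS')).
  have n3 k : pi.-negligible ((phi @^-1` B k) `*` ~` (psi @^-1` B k) `|`
      ~` (phi @^-1` B k) `*` (psi @^-1` B k)).
    have [k1 k2] := pik k; apply: negligibleU; apply/negligibleP => //.
      by apply: borel_setX; [exact: mphi|apply: measurableC; exact: mpsi].
    by apply: borel_setX; [apply: measurableC; exact: mphi|exact: mpsi].
  apply: negligibleS (negligibleU (negligibleU n1 n2) (negligible_bigcup n3)).
  move=> [x y] ng; have [Sx|nSx] := pselect (spt M x); last by left; left.
  have [Sy|nSy] := pselect (spt M' y); last by left; right.
  right; apply: contrapT => nk; apply: ng; split => //=.
  (* Off the null sets [n3] both points have the same code, so every neighbourhood of [phi x]
     contains [psi y]. *)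
  have Bk k : B k (phi x) <-> B k (psi y).
    split=> h; apply: contrapT => h'; apply: nk; exists k => //.
      by left; split.
    by right; split.
  apply: (tame_hausdorff tQ) => A A' nA nA'.
  move: nA; rewrite nbhsE => -[U [oU Ux] UA].
  have [k [/Bk Bx BU]] := bB _ _ oU Ux.
  by exists (psi y); split; [exact/UA/BU|exact: nbhs_singleton].
have [N [mN N0 Ngood]] := neg.
have e1 : (pi \x pi)%E (N `*` setT) = 0%E.
  by rewrite product_measure1E// [X in (X * _)%E]N0 mul0e.
have e2 : (pi \x pi)%E (setT `*` N) = 0%E.
  by rewrite product_measure1E// [X in (_ * X)%E]N0 mule0.
have nl : (pi \x pi)%E.-negligible (N `*` setT).
  by exists (N `*` setT); split => //; exact: measurableX.
have nr : (pi \x pi)%E.-negligible (setT `*` N).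
  by exists (setT `*` N); split => //; exact: measurableX.
apply: negligibleS (negligibleU nl nr) => -[p r] /= nE.
have [gp|/Ngood Np] := pselect (good p); last by left; split.
have [gr|/Ngood Nr] := pselect (good r); last by right; split.
exfalso; apply: nE; have [Sp Sp' ep] := gp; have [Sr Sr' er] := gr.
rewrite -(qmap_tsep Sp Sr) iotaE -(qmap_tsep Sp' Sr').
by move: ep er; rewrite /phi/psi => -> ->.
Qed.

(** The quotient of [M] itself serves as [Mh], with the identity and the isomorphism as the two
    maps. Every point other than its boundary lies in the support by [qi0_meas_gt0]. *)
Lemma isomorphic_common_extension : isomorphic M M' ->
  exists (Mh : nblmms R) (ih : Mh)
              (iotah : borel (tspace Mh) -> borel (qi0_space M))
              (iotah' : borel (tspace Mh) -> borel (qi0_space M')),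
         [/\ is_spacelike_boundary (tsep Mh) ih,
             spt Mh `|` [set ih] = setT,
             [/\ distance_preserving (tsep Mh) (qi0_tsep M) iotah,
                 measurable_fun setT iotah &
                 forall A, measurable A ->
                   pushforward (meas Mh) iotah A = qi0_meas M A] &
             [/\ distance_preserving (tsep Mh) (qi0_tsep M') iotah',
                 measurable_fun setT iotah' &
                 forall A, measurable A ->
                   pushforward (meas Mh) iotah' A = qi0_meas M' A]].
Proof.
move=> [iota [iotaE miota iota_push]].
have [P PE] := qi0_probability M; have [i bi] := qi0_boundary M.
exists (NBLMMS (qi0_blms M) P), i, id, iota; split => //.
- apply/seteqP; split => // a _.
  have [ba|nb] := pselect (is_spacelike_boundary (qi0_tsep M) a).
    by right; exact: (blms_boundary_unique (qi0_blms M)).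
  by left => U oU Ua; rewrite /= PE; exact: qi0_meas_gt0 nb.
- split; [by move=> x y|exact: (@measurable_id _ (borel (qi0_space M)) setT)|].
  by move=> A mA; rewrite /pushforward PE qi0_measE.
- split => // A mA; rewrite -iota_push// /pushforward PE qi0_measE//.
  by rewrite -[Z in measurable Z]setTI; exact: miota.
Qed.

Lemma coupling_isomorphic (pi : probability (borel (tspace M * tspace M')%type) R) :
  is_coupling pi ->
  (\forall p \ae (pi \x pi)%E, tsep M p.1.1 p.2.1 = tsep M' p.1.2 p.2.2) ->
  isomorphic M M'.
Proof.
move=> [pi1 pi2] [N [mN N0 aeN]].
pose S : set (T * T') := support pi.
have S0 : pi (~` S) = 0%E.
  apply: measure_setC_support; apply: tame_base_prod.
    exact: blms_tame tauP.
  exact: blms_tame tauP'.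
have cS : closed S by exact: support_closed.
have mS : measurable (S : set (borel (T * T')%type)) by exact: borel_closed.
have S1 p : S p -> spt M p.1.
  move=> Sp U oU Up; rewrite -pi1; last exact: borel_open.
  apply: Sp => //; apply: open_comp => // q _; exact: cvg_fst.
have S2 p : S p -> spt M' p.2.
  move=> Sp U oU Up; rewrite -pi2; last exact: borel_open.
  apply: Sp => //; apply: open_comp => // q _; exact: cvg_snd.
(* Neighbourhoods of points of the support have positive mass, so their product is not contained in
   the null set [N]; continuity turns the almost sure identity into one on all of [S]. *)
have Seq p r : S p -> S r -> tsep M p.1 r.1 = tsep M' p.2 r.2.
  move=> Sp Sr; apply: (@Rhausdorff R) => A B nA nB.
  have [[U1 V1] [/= nU1 nV1] UV1] :
      nbhs (p.1, r.1) ((fun q => tsep M q.1 q.2) @^-1` A).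
    exact: (@blms_continuous _ _ _ tauP (p.1, r.1) A nA).
  have [[U2 V2] [/= nU2 nV2] UV2] :
      nbhs (p.2, r.2) ((fun q => tsep M' q.1 q.2) @^-1` B).
    exact: (@blms_continuous _ _ _ tauP' (p.2, r.2) B nB).
  have nU : nbhs p (U1 `*` U2) by exists (U1, U2).
  have nV : nbhs r (V1 `*` V2) by exists (V1, V2).
  move: nU nV; rewrite !nbhsE => -[U [oU Up] UU] [V [oV Vr] VV].
  have mU : measurable (U : set (borel (T * T')%type)) by exact: borel_open.
  have mV : measurable (V : set (borel (T * T')%type)) by exact: borel_open.
  have [[q1 q2] [[/= Uq Vq] nq]] : exists q, (U `*` V) q /\ ~ N q.
    apply: contrapT => /forallNP h.
    have : ((pi \x pi)%E (U `*` V) <= 0)%E.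
      rewrite -N0; apply: le_measure; rewrite ?inE//; first exact: measurableX.
      by move=> q UVq; apply: contrapT => nq; apply: (h q).
    rewrite product_measure1E// leNgt => /negP; apply.
    by apply: mule_gt0; [exact: Sp|exact: Sr].
  have eq12 : tsep M q1.1 q2.1 = tsep M' q1.2 q2.2.
    by apply: contrapT => ne; apply: nq; apply: aeN.
  exists (tsep M q1.1 q2.1); have [u1 u2] := UU _ Uq; have [v1 v2] := VV _ Vq.
  by split; [exact: (UV1 (q1.1, q2.1))|rewrite eq12; exact: (UV2 (q1.2, q2.2))].
pose h (p : T * T') : qi0 M := qmap p.1.
pose h' (p : T * T') : qi0 M' := qmap p.2.
(* By [Seq] a lower bound on the separation in [M] is one in [M'] too, so both coordinates of [p]
   are confined at once. *)
have compactS r (e : R) : S r -> 0 < e -> exists2 C : set (T * T'), compact C &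
    forall p, S p -> e <= tsep M p.1 r.1 \/ e <= tsep M r.1 p.1 -> C p.
  move=> Sr e0.
  pose K := [set q : T * T | e <= tsep M q.1 q.2].
  pose K' := [set q : T' * T' | e <= tsep M' q.1 q.2].
  have cK : compact K by exact: (blms_compact tauP e0).
  have cK' : compact K' by exact: (blms_compact tauP' e0).
  exists ((fst @` K) `*` (fst @` K') `|` (snd @` K) `*` (snd @` K')).
    by apply: compactU; apply: compact_setX; apply: continuous_compact => //;
      apply: continuous_subspaceT => q; (exact: cvg_fst || exact: cvg_snd).
  move=> p Sp [ep|ep]; [left|right]; split => /=.
  - by exists (p.1, r.1).
  - by exists (p.2, r.2) => //; rewrite /K'/= -Seq.
  - by exists (r.1, p.1).
  - by exists (r.2, p.2) => //; rewrite /K'/= -Seq.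
have pi_hit (X : set (borel (T * T')%type)) : measurable X -> (0 < pi X)%E ->
    exists2 p, S p & X p.
  move=> mX; rewrite -(measure_setI_full mS S0 mX) => pX.
  have [p [Sp Xp]] : (S `&` X) !=set0; last by exists p.
  by apply/set0P/eqP => e; move: pX; rewrite e measure0 ltxx.
have mqU (M0 : nblmms R) (U : set (qi0_space M0)) : open U ->
    measurable (qmap @^-1` U : set (borel (tspace M0))).
  move=> oU; rewrite -[Z in measurable Z]setTI; apply: measurable_qmap => //.
  exact: borel_open.
have contf (f : T -> R) : continuous f -> continuous (fun p : T * T' => f p.1).
  by move=> cf p; apply: (continuous_comp (f := fst)); [exact: cvg_fst|exact: cf].
have conts (f : T' -> R) : continuous f -> continuous (fun p : T * T' => f p.2).
  by move=> cf p; apply: (continuous_comp (f := snd)); [exact: cvg_snd|exact: cf].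
have [||||iota [iotaE ciota iotah]] := @isometry_transfer R (qi0 M) (qi0 M')
  (qi0_tsep M) (qi0_tsep M') (qi0_blms M) (qi0_blms M') (T * T')%type S h h'.
- apply: (dense_isometry_hits (qi0_blms M) (P := (T * T')%type)
    (S := S) (h := h) (s := fun p r => tsep M p.1 r.1)) => //.
  + by move=> r; apply: (contf (tsep M^~ r.1)); exact: blms_continuousr tauP _.
  + by move=> r; apply: (contf (tsep M r.1)); exact: blms_continuousl tauP _.
  + by move=> p r Sp Sr; apply: qmap_tsep; exact: S1.
  + move=> y U nb oU Uy; apply: (pi_hit (fst @^-1` (qmap @^-1` U))).
      by apply: measurable_fst_preimage; exact: mqU.
    have := pi1 _ (mqU M U oU); rewrite /pushforward => ->.
    exact: qi0_meas_gt0 nb.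
- apply: (dense_isometry_hits (qi0_blms M') (P := (T * T')%type)
    (S := S) (h := h') (s := fun p r => tsep M' p.2 r.2)) => //.
  + by move=> r; apply: (conts (tsep M'^~ r.2)); exact: blms_continuousr tauP' _.
  + by move=> r; apply: (conts (tsep M' r.2)); exact: blms_continuousl tauP' _.
  + by move=> p r Sp Sr; apply: qmap_tsep; exact: S2.
  + move=> r e Sr e0; have [C cC CP] := compactS r e Sr e0; exists C => // p Sp.
    by rewrite -!Seq//; exact: CP.
  + move=> y U nb oU Uy; apply: (pi_hit (snd @^-1` (qmap @^-1` U))).
      by apply: measurable_snd_preimage; exact: mqU.
    have := pi2 _ (mqU M' U oU); rewrite /pushforward => ->.
    exact: qi0_meas_gt0 nb.
- exact: qi0_boundary.
- move=> p r Sp Sr; rewrite /h/h' !qmap_tsep; [exact: Seq|..];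
    by [exact: S1|exact: S2].
have miota : measurable_fun setT (iota : borel (qi0_space M) -> borel (qi0_space M')).
  exact: continuous_measurable_borel.
exists iota; split => // A mA.
have mA1 : measurable (iota @^-1` A : set (borel (qi0_space M))).
  by rewrite -[Z in measurable Z]setTI; exact: miota.
have mA2 : measurable (qmap @^-1` (iota @^-1` A) : set (borel T)).
  by rewrite -[Z in measurable Z]setTI; exact: (measurable_qmap (M := M)).
have mA3 : measurable (qmap @^-1` A : set (borel T')).
  by rewrite -[Z in measurable Z]setTI; exact: (measurable_qmap (M := M')).
rewrite /pushforward !qi0_measE// -(pi1 _ mA2) -(pi2 _ mA3) /pushforward.
(* [iota] carries [h] to [h'] on [S] only, so both preimages are first cut down to this set of full
   measure. *)
rewrite -(measure_setI_full mS S0 (measurable_fst_preimage mA2)).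
rewrite -[RHS](measure_setI_full mS S0 (measurable_snd_preimage mA3)).
congr (pi _); apply/seteqP; split=> p [Sp Ap]; split => //.
  by move: Ap; rewrite /= -/(h p) iotah.
by rewrite /= -/(h p) iotah.
Qed.

Lemma common_extension_isomorphic (Mh : nblmms R)
    (iotah : borel (tspace Mh) -> borel (qi0_space M))
    (iotah' : borel (tspace Mh) -> borel (qi0_space M')) :
  distance_preserving (tsep Mh) (qi0_tsep M) iotah ->
  (forall A, measurable A -> pushforward (meas Mh) iotah A = qi0_meas M A) ->
  distance_preserving (tsep Mh) (qi0_tsep M') iotah' ->
  (forall A, measurable A -> pushforward (meas Mh) iotah' A = qi0_meas M' A) ->
  isomorphic M M'.
Proof.
move=> hE hpush hE' hpush'; have hP := tsepP Mh.
have compactS r (e : R) : [set: tspace Mh] r -> 0 < e ->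
    exists2 C : set (tspace Mh), compact C &
    forall p, setT p -> e <= tsep Mh p r \/ e <= tsep Mh r p -> C p.
  move=> _ e0; pose K := [set q : tspace Mh * tspace Mh | e <= tsep Mh q.1 q.2].
  have cK : compact K by exact: (blms_compact hP e0).
  exists (fst @` K `|` snd @` K).
    by apply: compactU; apply: continuous_compact => //;
      apply: continuous_subspaceT => q; [exact: cvg_fst|exact: cvg_snd].
  by move=> p _ [ep|ep]; [left; exists (p, r)|right; exists (r, p)].
have hit (M0 : nblmms R) (j : borel (tspace Mh) -> borel (qi0_space M0)) :
    distance_preserving (tsep Mh) (qi0_tsep M0) j ->
    (forall A, measurable A -> pushforward (meas Mh) j A = qi0_meas M0 A) ->
    forall y, ~ is_spacelike_boundary (qi0_tsep M0) y ->
      exists2 p, [set: tspace Mh] p & j p = y.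
  move=> jE jpush.
  apply: (dense_isometry_hits (qi0_blms M0) (P := tspace Mh) (s := tsep Mh)) => //.
  - exact: blms_continuousr hP.
  - exact: blms_continuousl hP.
  - move=> y U nb oU Uy.
    (* Density comes from the measures: [U] has positive image measure, hence a nonempty
       preimage. *)
    have [p Up] : (j @^-1` U) !=set0; last by exists p.
    apply/set0P/eqP => e.
    have := qi0_meas_gt0 oU Uy nb; rewrite -qi0_measE; last exact: borel_open.
    rewrite -jpush; last exact: borel_open.
    by rewrite /pushforward e measure0 ltxx.
have [||||iota [iotaE ciota iotahE]] := @isometry_transfer R (qi0 M) (qi0 M')
  (qi0_tsep M) (qi0_tsep M') (qi0_blms M) (qi0_blms M') (tspace Mh) setT iotah iotah'.
- exact: (hit M iotah).
- exact: (hit M' iotah').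
- exact: qi0_boundary.
- by move=> p r _ _; rewrite -hE -hE'.
have miota : measurable_fun setT (iota : borel (qi0_space M) -> borel (qi0_space M')).
  exact: continuous_measurable_borel.
exists iota; split => // A mA.
rewrite -hpush' // /pushforward -hpush; last first.
  by rewrite -[Z in measurable Z]setTI; exact: miota.
rewrite /pushforward; congr (meas Mh _); apply/seteqP; split=> p /=;
  by rewrite iotahE.
Qed.

End Isomorphy.

Theorem lemma2p20 (R : realType) (M M' : nblmms R) :
  [<-> isomorphic M M';
       exists2 pi : probability (borel (tspace M * tspace M')%type) R,
         is_coupling pi &
         \forall p \ae (pi \x pi)%E, tsep M p.1.1 p.2.1 = tsep M' p.1.2 p.2.2;
       exists (Mh : nblmms R) (ih : Mh)
              (iotah : borel (tspace Mh) -> borel (qi0_space M))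
              (iotah' : borel (tspace Mh) -> borel (qi0_space M')),
         [/\ is_spacelike_boundary (tsep Mh) ih,
             spt Mh `|` [set ih] = setT,
             [/\ distance_preserving (tsep Mh) (qi0_tsep M) iotah,
                 measurable_fun setT iotah &
                 forall A, measurable A ->
                   pushforward (meas Mh) iotah A = qi0_meas M A] &
             [/\ distance_preserving (tsep Mh) (qi0_tsep M') iotah',
                 measurable_fun setT iotah' &
                 forall A, measurable A ->
                   pushforward (meas Mh) iotah' A = qi0_meas M' A]]].
Proof.
tfae.
- exact: isomorphic_coupling.
- move=> [pi cpi ae]; apply: isomorphic_common_extension.
  exact: (coupling_isomorphic cpi ae).
- move=> [Mh [ih [iotah [iotah' [_ _ [h1 _ h2] [h3 _ h4]]]]]].
  exact: (common_extension_isomorphic h1 h2 h3 h4).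
Qed.
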